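(* Let $(A,\mathfrak m)$ be a two-dimensional Cohen-Macaulay (Noetherian) local ring with infinite residue field and let $I$ be an $\mathfrak m$-primary integrally closed ideal of $A$. If $e_2(I)=e_1(I)-e_0(I)+\lambda(A/I)$, then $\operatorname{depth}G(I)=0$ or $\operatorname{depth}G(I)=2$.
   Context: $\lambda(-)$ denotes length. For an $\mathfrak m$-primary ideal $I$ of a $d$-dimensional Noetherian local ring $(A,\mathfrak m)$, the Hilbert coefficients $e_0(I),\dots,e_d(I)$ are the integers such that, for all $n\gg 0$, $\lambda(A/I^{n+1})=e_0(I)\binom{n+d}{d}-e_1(I)\binom{n+d-1}{d-1}+\cdots+(-1)^d e_d(I)$. $G(I)=\bigoplus_{n\ge 0}I^n/I^{n+1}$ is the associated graded ring of $I$, and its depth is taken with respect to its unique homogeneous maximal ideal. *)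

(* Defs.v *)
(* MathComp, with the classical layer of MathComp-Analysis.

   Ideals are boolean predicates, as in ring_quotient: [idealr R] is the type
   of proper ideals, [idealr_closed] the corresponding property.  Arbitrary
   propositions are turned into booleans by [asbool], so that every ideal in the
   usual sense is covered. *)
From HB Require Import structures.
From mathcomp Require Import all_boot all_order all_algebra.
From mathcomp Require Import boolp classical_sets functions cardinality.

Set Implicit Arguments.
Unset Strict Implicit.
Unset Printing Implicit Defensive.

Import GRing.Theory.
Local Open Scope ring_scope.

Section Ideals.
Variable R : comNzRingType.
Implicit Types (I J K P : {pred R}) (x y : R) (s : seq R).

(* Contrary to [idealr_closed], the unit ideal is allowed. *)
Definition ideal_closed J : Prop :=
  0 \in J /\ forall a, {in J &, forall u v, a * u + v \in J}.

Definition ideal_lt J K : Prop := {subset J <= K} /\ ~ {subset K <= J}.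

Definition ideal_gen s : {pred R} :=
  [pred y | `[< exists c : 'I_(size s) -> R,
                  y = \sum_(i < size s) c i * s`_i >]].

Definition ideal_mul J K : {pred R} :=
  [pred y | `[< exists s : seq (R * R),
                  {in s, forall u, (u.1 \in J) && (u.2 \in K)} /\
                  y = \sum_(u <- s) u.1 * u.2 >]].

(* I ^ 0 is the unit ideal. *)
Definition ideal_exp I n : {pred R} := iter n (ideal_mul I) predT.

Definition radical J : {pred R} := [pred x | `[< exists n, x ^+ n \in J >]].

Definition prime_ideal P : Prop := idealr_closed P /\ prime_idealr_closed P.

Definition maximal_ideal J : Prop :=
  idealr_closed J /\
  forall K, idealr_closed K -> {subset J <= K} -> {subset K <= J}.

Definition primary_ideal J : Prop :=
  idealr_closed J /\
  forall x y, x * y \in J -> x \in J \/ y \in radical J.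

Definition primary_to P J : Prop := primary_ideal J /\ radical J =i P.

(* x ^ n + a_1 x ^ (n - 1) + ... + a_n = 0 with a_i in I ^ i and 0 < n *)
Definition integral_over_ideal I x : Prop :=
  exists n (a : nat -> R),
    [/\ (0 < n)%N,
        forall i, (0 < i <= n)%N -> a i \in ideal_exp I i
      & x ^+ n + \sum_(1 <= i < n.+1) a i * x ^+ (n - i) = 0].

Definition integrally_closed I : Prop :=
  forall x, integral_over_ideal I x -> x \in I.

(* A strict chain of n + 1 ideals from J to R, that is, a strict chain of
   submodules of R / J from 0 to R / J. *)
Definition quot_chain J n : Prop :=
  exists C : nat -> {pred R},
    [/\ C 0%N =i J, C n =i predT,
        forall i, (i <= n)%N -> ideal_closed (C i)
      & forall i, (i < n)%N -> ideal_lt (C i) (C i.+1)].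

(* R / J has finite length, equal to n. *)
Definition quot_length J n : Prop :=
  quot_chain J n /\ forall k, quot_chain J k -> (k <= n)%N.

(* The e_i are the Hilbert coefficients of I, for R of dimension d. *)
Definition hilbert_coefs d I (e : nat -> int) : Prop :=
  exists N, forall n, (N <= n)%N ->
    exists2 l, quot_length (ideal_exp I n.+1) l &
      l%:Z = \sum_(i < d.+1) (-1) ^+ i * e i * 'C(n + (d - i), d - i)%:Z.

Definition regular_seq s : Prop :=
  (forall i a, (i < size s)%N ->
     s`_i * a \in ideal_gen (take i s) -> a \in ideal_gen (take i s)) /\
  1 \notin ideal_gen s.

(* k is the largest length of a regular sequence of elements of J. *)
Definition depth J k : Prop :=
  (exists s, [/\ size s = k, {subset s <= J} & regular_seq s]) /\
  forall s, {subset s <= J} -> regular_seq s -> (size s <= k)%N.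

End Ideals.

Definition noetherian (R : comNzRingType) : Prop :=
  forall J : {pred R}, ideal_closed J -> exists s, J =i ideal_gen s.

Definition local_ring (R : comNzRingType) (m : {pred R}) : Prop :=
  maximal_ideal m /\ forall n : {pred R}, maximal_ideal n -> n =i m.

Definition prime_chain (R : comNzRingType) (n : nat) : Prop :=
  exists P : nat -> {pred R},
    (forall i, (i <= n)%N -> prime_ideal (P i)) /\
    (forall i, (i < n)%N -> ideal_lt (P i) (P i.+1)).

Definition krull_dim (R : comNzRingType) (n : nat) : Prop :=
  prime_chain R n /\ forall k, prime_chain R k -> (k <= n)%N.

(* For a Noetherian local ring R with maximal ideal m. *)
Definition cohen_macaulay (R : comNzRingType) (m : {pred R}) : Prop :=
  exists2 d, krull_dim R d & depth m d.

Section IdealExp.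
Variables (R : comNzRingType) (I : idealr R).
Implicit Types (J K : {pred R}).

Lemma ideal_mul_closed J K : ideal_closed J -> ideal_closed (ideal_mul J K).
Proof.
move=> [J0 JD]; split; first by apply/asboolP; exists [::]; rewrite big_nil.
move=> a u v /asboolP[s [sP ->]] /asboolP[t [tP ->]]; apply/asboolP.
exists ([seq (a * w.1, w.2) | w <- s] ++ t); split.
  move=> w; rewrite mem_cat => /orP[/mapP[z zs ->]|/tP//] /=.
  have /andP[zJ ->] := sP _ zs; rewrite andbT -[_ * _]addr0.
  exact: JD.
rewrite big_cat big_map mulr_sumr /=; congr (_ + _).
by apply: eq_bigr => w _; rewrite mulrA.
Qed.

Lemma idealr_ideal_closed : ideal_closed I.
Proof.
split; first exact: rpred0.
by move=> a u v uI vI; rewrite rpredD // idealMr.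
Qed.

Lemma ideal_exp_closed n : ideal_closed (ideal_exp I n).
Proof.
case: n => [|n]; first by split.
exact/ideal_mul_closed/idealr_ideal_closed.
Qed.

Lemma ideal_exp0 n : 0 \in ideal_exp I n.
Proof. by case: (ideal_exp_closed n). Qed.

Lemma ideal_expD n x y :
  x \in ideal_exp I n -> y \in ideal_exp I n -> x + y \in ideal_exp I n.
Proof.
by have [_ D] := ideal_exp_closed n; move=> xI yI; rewrite -[x]mul1r D.
Qed.

Lemma ideal_expMl n a x : x \in ideal_exp I n -> a * x \in ideal_exp I n.
Proof.
have [Z D] := ideal_exp_closed n; move=> xI.
by rewrite -[_ * _]addr0 D.
Qed.

Lemma ideal_exp_sum n (T : Type) (r : seq T) (Q : pred T) (F : T -> R) :
  (forall i, Q i -> F i \in ideal_exp I n) ->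
  \sum_(i <- r | Q i) F i \in ideal_exp I n.
Proof.
move=> FI; apply: (big_ind (fun x => x \in ideal_exp I n)) => //.
- exact: ideal_exp0.
- exact: ideal_expD.
Qed.

Lemma ideal_expS_sub n : {subset ideal_exp I n.+1 <= ideal_exp I n}.
Proof.
move=> x /asboolP[s [sP ->]]; rewrite big_seq; apply: ideal_exp_sum => u us.
by have /andP[_ uI] := sP _ us; apply: ideal_expMl.
Qed.

Lemma ideal_expM i j x y :
  x \in ideal_exp I i -> y \in ideal_exp I j -> x * y \in ideal_exp I (i + j).
Proof.
elim: i x => [|i IHi] x; first by move=> _; apply: ideal_expMl.
move=> /asboolP[s [sP ->]] yI; rewrite mulr_suml big_seq.
apply: ideal_exp_sum => u us; have /andP[u1 u2] := sP _ us.
apply/asboolP; exists [:: (u.1, u.2 * y)]; rewrite big_seq1 mulrA; split=> //.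
by move=> w; rewrite inE => /eqP-> /=; rewrite u1 IHi.
Qed.

Lemma ideal_exp1 x : x \in ideal_exp I 1 -> x \in I.
Proof.
move=> /asboolP[s [sP ->]]; rewrite big_seq; apply: rpred_sum => u us.
by have /andP[uI _] := sP _ us; rewrite mulrC idealMr.
Qed.

(* The Rees algebra, as the subring of the p : {poly R} with p`_i in I ^ i. *)
Definition rees_pred : {pred {poly R}} :=
  fun p => `[< forall i, p`_i \in ideal_exp I i >].

Fact rees_subring_closed : subring_closed rees_pred.
Proof.
split.
- by apply/asboolP => -[|i]; rewrite coef1 // ideal_exp0.
- move=> p q /asboolP pI /asboolP qI; apply/asboolP => i.
  by rewrite coefB -mulN1r ideal_expD // ideal_expMl.
- move=> p q /asboolP pI /asboolP qI; apply/asboolP => i.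
  rewrite coefM; apply: ideal_exp_sum => j _.
  by have := ideal_expM (pI j) (qI (i - j)%N); rewrite subnKC // -ltnS.
Qed.

HB.instance Definition _ :=
  GRing.isSubringClosed.Build {poly R} rees_pred rees_subring_closed.

Record rees := Rees { rees_val :> {poly R}; _ : rees_val \in rees_pred }.

HB.instance Definition _ := [isSub for rees_val].
HB.instance Definition _ := [Choice of rees by <:].
HB.instance Definition _ := [SubChoice_isSubComNzRing of rees by <:].

(* The ideal I * rees: the direct sum of the I ^ (n + 1) in that of the I ^ n. *)
Definition rees_shift : {pred rees} :=
  fun p => `[< forall i, (rees_val p)`_i \in ideal_exp I i.+1 >].

Fact rees_shift_closed : idealr_closed rees_shift.
Proof.
split.
- by apply/asboolP => i; rewrite coef0 ideal_exp0.
- by apply/asboolP => /(_ 0%N); rewrite coef1 => /ideal_exp1; rewrite idealr1.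
- move=> a u v /asboolP uI /asboolP vI; apply/asboolP => i.
  rewrite coefD coefM ideal_expD //; apply: ideal_exp_sum => j _.
  have /asboolP aI := valP a.
  by have := ideal_expM (aI j) (uI (i - j)%N); rewrite addnS subnKC // -ltnS.
Qed.

HB.instance Definition _ := isIdealr.Build rees rees_shift rees_shift_closed.

(* The associated graded ring G(I), whose n-th graded piece I ^ n / I ^ (n + 1)
   consists of the classes of the monomials a *: 'X^n with a in I ^ n. *)
Definition assoc_graded : comNzRingType := {ideal_quot rees_shift}.

(* m / I + I / I ^ 2 + I ^ 2 / I ^ 3 + ..., which is the homogeneous maximal ideal
   of G(I) when m is the maximal ideal of a local ring R. *)
Definition graded_max (m : {pred R}) : {pred assoc_graded} :=
  [pred g | `[< exists2 p : rees,
                  g = \pi_({ideal_quot rees_shift})%qT p & p`_0 \in m >]].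

End IdealExp.
Arguments rees_shift {R} I.
Arguments graded_max {R} I m.

(* Main.v *)
Require Import Defs.
From HB Require Import structures.
From mathcomp Require Import all_boot all_order all_algebra.
From mathcomp Require Import boolp classical_sets functions cardinality.
From mathcomp Require Import perm ring zify.

Set Implicit Arguments.
Unset Strict Implicit.
Unset Printing Implicit Defensive.

Import GRing.Theory.
Local Open Scope ring_scope.

(* If G(I) has no regular element in its homogeneous maximal ideal, its depth
   is 0.  Otherwise no nonzero element of G(I) is killed by G(I)_1, so a generic
   [a] in I has a regular symbol, and a second generic element [b] makes
   J = (a, b) a reduction of I: the graded pieces of G(I)/(a) have eventually
   constant length, so the injective map [b] is eventually onto.  As A is
   Cohen-Macaulay, [a, b] have only trivial relations.

   Put v_n = length (I^n / J I^(n-1)), and let f n be the difference between the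
   Hilbert polynomial and length (A / I^n).  The second difference of f at n is
   v_(n+2), so f is convex; it is eventually 0, and the hypothesis on e_2 says
   f 1 = 0.  Hence f n = 0 for n >= 1, that is, I^n = J I^(n-1) for n >= 3.

   It remains to see that J meets I^2 in J I, which is a case of a theorem of
   Huneke and Itoh: if a x + b y lies in I^2, then x lies in the integral closure
   of I.  Take the largest ideal N with I N = J N.  By maximality
   N = (J^k N : J^k) for all k, so (J^2 N : J) = J N.  For u in N, the element
   (a x + b y) u is in J^2 N, so there is h with x u - b h and y u + a h in J N;
   the ideal N' of all such h contains N and satisfies I N' = J N', whence h is
   in N, x N is contained in J N, and x is integral over I.

   Finally the symbols of [a, b] form a regular sequence, and no regular sequence
   of length 3 consists of elements nilpotent modulo (a, b). *)

(** * Ideals and colengths *)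

Section Ideals.
Variable R : comNzRingType.
Implicit Types (J K L N W D E : {pred R}) (a b c x y : R).

Lemma eq_ideal J K : {subset J <= K} -> {subset K <= J} -> J = K.
Proof.
by move=> JK KJ; apply: funext => x; apply/idP/idP; [exact: JK|exact: KJ].
Qed.

Lemma ideal0 J : ideal_closed J -> 0 \in J.
Proof. by case. Qed.

Lemma idealD J x y : ideal_closed J -> x \in J -> y \in J -> x + y \in J.
Proof. by move=> [_ JD] xJ yJ; rewrite -[x]mul1r JD. Qed.

Lemma idealMl J a x : ideal_closed J -> x \in J -> a * x \in J.
Proof. by move=> [J0 JD] xJ; rewrite -[a * x]addr0 JD. Qed.

Lemma idealMr J x a : ideal_closed J -> x \in J -> x * a \in J.
Proof. by rewrite mulrC; exact: idealMl. Qed.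

Lemma idealN J x : ideal_closed J -> x \in J -> - x \in J.
Proof. by move=> Jc xJ; rewrite -mulN1r idealMl. Qed.

Lemma idealB J x y : ideal_closed J -> x \in J -> y \in J -> x - y \in J.
Proof. by move=> Jc xJ yJ; rewrite idealD // idealN. Qed.

Lemma ideal_sum J (T : eqType) (r : seq T) (F : T -> R) :
  ideal_closed J -> {in r, forall i, F i \in J} -> \sum_(i <- r) F i \in J.
Proof.
move=> Jc FJ; rewrite big_seq.
apply: (big_ind (fun x => x \in J)) => //; first exact: ideal0.
by move=> x y; exact: idealD.
Qed.

Lemma idealDr J x y : ideal_closed J -> y \in J -> (x + y \in J) = (x \in J).
Proof.
move=> Jc yJ; apply/idP/idP => [xyJ|xJ]; last exact: idealD.
by rewrite -[x](addrK y) idealB.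
Qed.

Lemma idealT : ideal_closed (predT : {pred R}).
Proof. by split. Qed.

Definition ideal_add J K : {pred R} :=
  [pred y | `[< exists u v, [/\ u \in J, v \in K & y = u + v] >]].

Definition ideal_scale c K : {pred R} :=
  [pred y | `[< exists2 x, x \in K & y = c * x >]].

Definition ideal_colon J c : {pred R} := [pred x | c * x \in J].

Definition ideal_cap J K : {pred R} := [pred x | (x \in J) && (x \in K)].

Definition principal c : {pred R} := ideal_scale c predT.

Lemma ideal_addP J K y :
  reflect (exists u v, [/\ u \in J, v \in K & y = u + v]) (y \in ideal_add J K).
Proof. exact: asboolP. Qed.

Lemma ideal_scaleP c K y :
  reflect (exists2 x, x \in K & y = c * x) (y \in ideal_scale c K).
Proof. exact: asboolP. Qed.

Lemma mem_ideal_scale c K x : x \in K -> c * x \in ideal_scale c K.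
Proof. by move=> xK; apply/ideal_scaleP; exists x. Qed.

Lemma ideal_add_closed J K :
  ideal_closed J -> ideal_closed K -> ideal_closed (ideal_add J K).
Proof.
move=> Jc Kc; split.
  by apply/ideal_addP; exists 0, 0; rewrite addr0; split => //; exact: ideal0.
move=> a _ _ /ideal_addP[u [v [uJ vK ->]]] /ideal_addP[u' [v' [uJ' vK' ->]]].
apply/ideal_addP; exists (a * u + u'), (a * v + v').
split; last by ring.
- by apply: idealD => //; apply: idealMl.
- by apply: idealD => //; apply: idealMl.
Qed.

Lemma ideal_scale_closed c K : ideal_closed K -> ideal_closed (ideal_scale c K).
Proof.
move=> Kc; split; first by apply/ideal_scaleP; exists 0; rewrite ?mulr0 ?ideal0.
move=> a _ _ /ideal_scaleP[x xK ->] /ideal_scaleP[y yK ->].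
apply/ideal_scaleP; exists (a * x + y); last by ring.
by apply: idealD => //; apply: idealMl.
Qed.

Lemma ideal_colon_closed J c : ideal_closed J -> ideal_closed (ideal_colon J c).
Proof.
move=> Jc; split; first by rewrite inE mulr0 ideal0.
move=> a u v; rewrite !inE => cu cv.
have -> : c * (a * u + v) = a * (c * u) + c * v by ring.
by apply: idealD => //; apply: idealMl.
Qed.

Lemma ideal_cap_closed J K :
  ideal_closed J -> ideal_closed K -> ideal_closed (ideal_cap J K).
Proof.
move=> Jc Kc; split; first by rewrite inE !ideal0.
move=> a u v; rewrite !inE => /andP[uJ uK] /andP[vJ vK].
by apply/andP; split; apply: idealD => //; apply: idealMl.
Qed.

Lemma principal_closed c : ideal_closed (principal c).
Proof. exact/ideal_scale_closed/idealT. Qed.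

Lemma principalP c y : reflect (exists x, y = c * x) (y \in principal c).
Proof.
by apply: (iffP (ideal_scaleP _ _ _)) => [[x _ ->]|[x ->]]; exists x.
Qed.

Lemma mem_ideal_addl J K x : ideal_closed K -> x \in J -> x \in ideal_add J K.
Proof.
by move=> Kc xJ; apply/ideal_addP; exists x, 0; rewrite addr0 ideal0.
Qed.

Lemma mem_ideal_addr J K x : ideal_closed J -> x \in K -> x \in ideal_add J K.
Proof.
by move=> Jc xK; apply/ideal_addP; exists 0, x; rewrite add0r ideal0.
Qed.

Lemma ideal_add_sub J K L : ideal_closed L ->
  {subset J <= L} -> {subset K <= L} -> {subset ideal_add J K <= L}.
Proof.
by move=> Lc JL KL _ /ideal_addP[u [v [/JL uL /KL vL ->]]]; exact: idealD.
Qed.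

Lemma ideal_cap_absorb J K : {subset J <= K} -> ideal_cap J K = J.
Proof.
move=> JK; apply: eq_ideal => x; rewrite inE; first by case/andP.
by move=> xJ; rewrite xJ JK.
Qed.

Lemma ideal_add_absorb J K :
  ideal_closed J -> ideal_closed K -> {subset J <= K} -> ideal_add J K = K.
Proof.
move=> Jc Kc JK; apply: eq_ideal; first exact: ideal_add_sub.
by move=> x; exact: mem_ideal_addr.
Qed.

Lemma ideal_lt_neq J K : {subset J <= K} -> J <> K -> ideal_lt J K.
Proof. by move=> JK JneK; split=> // KJ; apply: JneK; exact: eq_ideal. Qed.

(** Inductive counterpart of [quot_chain] with an arbitrary top, so that chains can be concatenated,
    mapped and split by induction. *)
Inductive chain : {pred R} -> {pred R} -> nat -> Prop :=
| chain0 N : ideal_closed N -> chain N N 0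
| chainS N K L n :
    ideal_closed N -> ideal_lt N K -> chain K L n -> chain N L n.+1.

Lemma chain_closedl N L n : chain N L n -> ideal_closed N.
Proof. by case. Qed.

Lemma chain_sub N L n : chain N L n -> {subset N <= L}.
Proof.
by elim=> [? _ x //|{}N K {}L {}n _ [NK _] _ KL x /NK /KL].
Qed.

Lemma chain_cat N K L i j : chain N K i -> chain K L j -> chain N L (i + j).
Proof.
by elim=> // {}N K' {}K {}i Nc NK' _ IH /IH; exact: chainS.
Qed.

Lemma chain1 N K : ideal_closed N -> ideal_closed K -> ideal_lt N K -> chain N K 1.
Proof. by move=> Nc Kc NK; apply: chainS NK _ => //; exact: chain0. Qed.

Lemma quot_chainE J n : ideal_closed J -> quot_chain J n <-> chain J predT n.
Proof.
move=> Jc; split.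
  case=> C [C0 Cn Cc Clt].
  have -> : J = C 0%N by apply: eq_ideal => x; rewrite C0.
  have -> : (predT : {pred R}) = C n by apply: eq_ideal => x; rewrite Cn.
  elim: n C {C0 Cn} Cc Clt => [|n IH] C Cc Clt; first exact/chain0/Cc.
  apply: chainS (Clt 0%N isT) _; first exact: Cc.
  by apply: (IH (fun i => C i.+1)) => i lti; [exact: Cc|exact: Clt].
suff ch_seq L : chain J L n -> exists C : nat -> {pred R},
    [/\ C 0%N =i J, C n =i L, forall i, (i <= n)%N -> ideal_closed (C i)
      & forall i, (i < n)%N -> ideal_lt (C i) (C i.+1)] by exact: ch_seq.
elim=> [N Nc|N K {}L k Nc NK KL [C [C0 Ck Cc Clt]]].
  by exists (fun=> N); split.
exists (fun i => if i is i'.+1 then C i' else N); split=> //.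
  by case=> [_|i]; [|exact: Cc].
case=> [_|i]; last exact: Clt.
case: NK => NK KN; split=> [x /NK|H]; rewrite ?C0 //.
by apply: KN => x xK; apply: H; rewrite C0.
Qed.

Lemma chain_map N K n (F : {pred R} -> {pred R}) :
  (forall D, ideal_closed D -> {subset N <= D} -> {subset D <= K} ->
     ideal_closed (F D)) ->
  (forall D E, ideal_closed D -> ideal_closed E -> {subset N <= D} ->
     {subset E <= K} -> ideal_lt D E -> ideal_lt (F D) (F E)) ->
  chain N K n -> chain (F N) (F K) n.
Proof.
move=> Fc Flt NK; elim: NK Fc Flt => [{}N Nc|{}N K' {}K {}n Nc NK' K'K IH] Fc Flt.
  by apply/chain0/Fc.
have K'c := chain_closedl K'K; have K'K_sub := chain_sub K'K.
apply: chainS; last apply: IH.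
- by apply: Fc => // x /(proj1 NK')/K'K_sub.
- exact: Flt.
- by move=> D Dc K'D DK; apply: Fc => // x /(proj1 NK')/K'D.
- by move=> D E Dc Ec K'D EK; apply: Flt => // x /(proj1 NK')/K'D.
Qed.

(* The modular law: a strict step stays strict after intersecting with [K] or
   after adding [K]. *)
Lemma chain_split N L n K : ideal_closed K -> chain N L n ->
  exists i j, [/\ (n <= i + j)%N, chain (ideal_cap N K) (ideal_cap L K) i
                & chain (ideal_add N K) (ideal_add L K) j].
Proof.
move=> Kc; elim=> [{}N Nc|{}N M {}L {}n Nc NM ML [i [j [le_n capi addj]]]].
  exists 0%N, 0%N; split=> //; apply: chain0.
    exact: ideal_cap_closed.
  exact: ideal_add_closed.
have Mc := chain_closedl ML; case: NM => NM MN.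
have capS : {subset ideal_cap N K <= ideal_cap M K}.
  by move=> x; rewrite !inE => /andP[/NM -> ->].
have addS : {subset ideal_add N K <= ideal_add M K}.
  by move=> _ /ideal_addP[u [v [/NM uM vK ->]]]; apply/ideal_addP; exists u, v.
have capc := ideal_cap_closed Nc Kc; have addc := ideal_add_closed Nc Kc.
have [capE|/(ideal_lt_neq capS) caplt] := pselect (ideal_cap N K = ideal_cap M K).
  have [addE|/(ideal_lt_neq addS) addlt] := pselect (ideal_add N K = ideal_add M K).
    case: MN => x xM; have : x \in ideal_add N K.
      by rewrite addE mem_ideal_addl.
    case/ideal_addP=> u [v [uN vK xE]].
    suff : v \in ideal_cap N K by rewrite inE xE => /andP[? _]; exact: idealD.
    rewrite capE inE vK andbT.
    have -> : v = x - u by rewrite xE addrC addKr.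
    by apply: idealB => //; exact: NM.
  exists i, j.+1; rewrite addnS; split=> //; first by rewrite capE.
  exact: chainS addlt addj.
(* The step may stay strict on both sides; the boolean is then an extra link of the second chain,
   which is why the lengths are only compared by an inequality. *)
exists i.+1, (j + (ideal_add N K != ideal_add M K))%N.
have [addE|/eqP/(ideal_lt_neq addS) addlt] := eqVneq (ideal_add N K) (ideal_add M K).
  by rewrite addn0 addSn; split=> //; [exact: chainS caplt capi|rewrite addE].
rewrite addn1 addSn; split; first by rewrite addnS; apply: leq_trans le_n _.
  exact: chainS caplt capi.
exact: chainS addlt addj.
Qed.

Definition finite_colength J := exists n, forall k, chain J predT k -> (k <= n)%N.

Definition is_length N K n := chain N K n /\ forall k, chain N K k -> (k <= n)%N.

(* 0 if [R / J] does not have finite length *)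
Definition colength J : nat :=
  if pselect (exists n, is_length J predT n) is left h then projT1 (cid h) else 0%N.

Lemma finite_colengthS J K : ideal_closed J -> {subset J <= K} ->
  finite_colength J -> finite_colength K.
Proof.
move=> Jc JK [n le_n]; exists n => k Kk.
have [JKE|/(ideal_lt_neq JK) JKlt] := pselect (J = K).
  by apply: le_n; rewrite JKE.
by apply: ltnW; apply: le_n; exact: chainS JKlt Kk.
Qed.

Lemma is_length_uniq N K n k : is_length N K n -> is_length N K k -> n = k.
Proof.
by move=> [nc nm] [kc km]; apply/eqP; rewrite eqn_leq nm // km.
Qed.

Lemma colengthE J n : is_length J predT n -> colength J = n.
Proof.
move=> Jn; rewrite /colength; case: pselect => [h|[]]; last by exists n.
by case: (cid h) => k /= Jk; exact: is_length_uniq Jk Jn.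
Qed.

Lemma colengthP J : ideal_closed J -> finite_colength J ->
  is_length J predT (colength J).
Proof.
move=> Jc [n le_n]; suff [k Jk] : exists k, is_length J predT k.
  by rewrite (colengthE Jk).
pose P k := `[< chain J predT k >].
have exP : exists k, P k.
  have JT : {subset J <= (predT : {pred R})} by [].
  have [JE|/(ideal_lt_neq JT) Jlt] := pselect (J = (predT : {pred R})).
    by exists 0%N; apply/asboolP; rewrite JE; exact/chain0/idealT.
  by exists 1%N; apply/asboolP; apply: chain1 => //; exact: idealT.
have leP k : P k -> (k <= n)%N by move/asboolP/le_n.
case: (ex_maxnP exP leP) => k /asboolP kP kmax; exists k; split=> // i Ji.
by apply: kmax; apply/asboolP.
Qed.

(** Additivity of length: splitting a longest chain above [N] along [K] gives one inequality,
    concatenating chains gives the other. *)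
Lemma colength_sub N K : ideal_closed N -> ideal_closed K -> {subset N <= K} ->
  finite_colength N ->
  exists2 n, is_length N K n & colength N = (n + colength K)%N.
Proof.
move=> Nc Kc NK Nfin; have Kfin := finite_colengthS Nc NK Nfin.
have [Nch Nmax] := colengthP Nc Nfin; have [Kch Kmax] := colengthP Kc Kfin.
have [i [j [le_ij]]] := chain_split Kc Nch.
rewrite (ideal_cap_absorb NK) (ideal_add_absorb Nc Kc NK).
have -> : ideal_cap (predT : {pred R}) K = K by apply: eq_ideal => x; rewrite !inE.
have -> : ideal_add (predT : {pred R}) K = (predT : {pred R}).
  by apply: eq_ideal => x // _; apply: mem_ideal_addl.
move=> iN jK; have le_j := Kmax _ jK.
have le_k k : chain N K k -> (k + colength K <= colength N)%N.
  by move=> kN; apply: Nmax; exact: chain_cat kN Kch.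
exists i; last by have := le_k _ iN; lia.
by split=> // k /le_k; lia.
Qed.

Lemma colength_le N K : ideal_closed N -> ideal_closed K -> {subset N <= K} ->
  finite_colength N -> (colength K <= colength N)%N.
Proof. by move=> Nc Kc NK /(colength_sub Nc Kc NK)[n _ ->]; exact: leq_addl. Qed.

Lemma colength_eq N K : ideal_closed N -> ideal_closed K -> {subset N <= K} ->
  finite_colength N -> (colength N <= colength K)%N -> N = K.
Proof.
move=> Nc Kc NK Nfin.
have [n [_ nmax] ->] := colength_sub Nc Kc NK Nfin => le_n.
case: (pselect (N = K)) => // /(ideal_lt_neq NK) /(chain1 Nc Kc)/nmax.
by lia.
Qed.

Lemma colengthT : colength predT = 0%N.
Proof.
apply: colengthE; split=> [|k]; first exact/chain0/idealT.
suff H N L n : chain N L n -> N = (predT : {pred R}) -> n = 0%N by move/H => ->.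
by case=> // {}N K {}L {}n _ [_ KN] _ NT; case: KN => x _; rewrite NT.
Qed.

(* Multiplication by [c] induces an isomorphism from [K / N] to [K' / N']. *)
Lemma colength_iso N K N' K' c :
  ideal_closed N -> ideal_closed K -> ideal_closed N' -> ideal_closed K' ->
  finite_colength N -> finite_colength N' ->
  {subset N <= K} -> {subset N' <= K'} ->
  (forall x, x \in K -> (c * x \in N') = (x \in N)) ->
  (forall x, x \in K -> c * x \in K') ->
  {subset K' <= ideal_add (ideal_scale c K) N'} ->
  (colength N + colength K' = colength N' + colength K)%N.
Proof.
move=> Nc Kc N'c K'c Nfin N'fin NK N'K' NN' KK' K'K.
have [n [nch nmax] ->] := colength_sub Nc Kc NK Nfin.
have [n' [nch' nmax'] ->] := colength_sub N'c K'c N'K' N'fin.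
suff -> : n = n' by lia.
apply/eqP; rewrite eqn_leq; apply/andP; split.
  (* Chains from [N] to [K] are pushed forward by [F]; strictness survives because [c] induces an
     injection on [K / N]. *)
  apply: nmax'; pose F D := ideal_add (ideal_scale c D) N'.
  have FNE : F N = N'.
    apply: eq_ideal; last by move=> x; exact/mem_ideal_addr/ideal_scale_closed.
    apply: ideal_add_sub => // _ /ideal_scaleP[x xN ->].
    by rewrite NN' ?NK.
  have FKE : F K = K'.
    apply: eq_ideal => //; apply: ideal_add_sub => // _ /ideal_scaleP[x xK ->].
    exact: KK'.
  rewrite -FNE -FKE; apply: chain_map nch.
    by move=> D Dc _ _; apply: ideal_add_closed => //; exact: ideal_scale_closed.
  move=> D E Dc Ec ND EK [DE ED]; split.
    move=> _ /ideal_addP[u [v [/ideal_scaleP[x /DE xE ->] vN' ->]]].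
    by apply/ideal_addP; exists (c * x), v; rewrite mem_ideal_scale.
  move=> FED; apply: ED => x xE.
  have /FED/ideal_addP[u [v [/ideal_scaleP[y yD ->] vN' cxE]]] : c * x \in F E.
    by apply: mem_ideal_addl => //; exact: mem_ideal_scale.
  rewrite -[x](subrK y); apply: idealD => //; apply: ND.
  rewrite -NN'; last by apply: idealB => //; apply: EK => //; exact: DE.
  by rewrite mulrBr cxE addrC addKr.
(* Chains from [N'] to [K'] are pulled back; strictness survives because [c] maps [K] onto [K']
   modulo [N']. *)
apply: nmax; pose F D := ideal_cap K (ideal_colon D c).
have FNE : F N' = N.
  apply: eq_ideal => x; rewrite !inE; first by case/andP=> xK; rewrite NN'.
  by move=> xN; rewrite NK //= NN' // NK.
have FKE : F K' = K.
  by apply: eq_ideal => x; rewrite !inE; [case/andP|move=> xK; rewrite xK KK'].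
rewrite -FNE -FKE; apply: chain_map nch'.
  by move=> D Dc _ _; apply: ideal_cap_closed => //; exact: ideal_colon_closed.
move=> D E Dc Ec N'D EK' [DE ED]; split.
  by move=> x; rewrite !inE => /andP[-> /DE].
move=> FED; apply: ED => y yE.
have /ideal_addP[u [v [/ideal_scaleP[x xK ->] vN' yE']]] := K'K _ (EK' _ yE).
have /N'D vD := vN'; rewrite yE' idealDr // in yE *; last exact: DE.
have /FED : x \in F E by rewrite inE xK.
by rewrite inE xK idealDr.
Qed.

End Ideals.

(** * Noetherian rings *)

Section Generators.
Variable R : comNzRingType.
Implicit Types (J K : {pred R}) (s t : seq R) (x y : R).

Lemma ideal_gen0 y : (y \in ideal_gen [::]) = (y == 0).
Proof.
apply/asboolP/eqP => [[c ->]|->]; first by rewrite big_ord0.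
by exists (fun=> 0); rewrite big_ord0.
Qed.

Lemma ideal_gen_consP x s y :
  reflect (exists c z, z \in ideal_gen s /\ y = c * x + z)
          (y \in ideal_gen (x :: s)).
Proof.
apply: (iffP (asboolP _)) => [[c ->]|[c [_ [/asboolP[d ->] ->]]]].
  exists (c ord0), (\sum_(i < size s) c (lift ord0 i) * s`_i); split.
    by apply/asboolP; exists (fun i => c (lift ord0 i)).
  by rewrite big_ord_recl.
exists (fun i => if unlift ord0 i is Some j then d j else c).
rewrite big_ord_recl unlift_none /=; congr (_ + _).
by apply: eq_bigr => i _; rewrite liftK.
Qed.

Lemma ideal_gen_closed s : ideal_closed (ideal_gen s).
Proof.
elim: s => [|x s IH]; split; rewrite ?ideal_gen0 //.
- by move=> a u v; rewrite !ideal_gen0 => /eqP-> /eqP->; rewrite mulr0 addr0.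
- by apply/ideal_gen_consP; exists 0, 0; rewrite ideal0 // mul0r addr0.
move=> a _ _ /ideal_gen_consP[c [z [zs ->]]] /ideal_gen_consP[d [w [ws ->]]].
apply/ideal_gen_consP; exists (a * c + d), (a * z + w); split; last by ring.
by apply: idealD => //; exact: idealMl.
Qed.

Lemma mem_ideal_gen s x : x \in s -> x \in ideal_gen s.
Proof.
elim: s => // y s IH; rewrite in_cons => /orP[/eqP->|/IH xs].
  apply/ideal_gen_consP; exists 1, 0; rewrite mul1r addr0; split=> //.
  exact/ideal0/ideal_gen_closed.
by apply/ideal_gen_consP; exists 0, x; rewrite mul0r add0r.
Qed.

Lemma ideal_gen_sub s J :
  ideal_closed J -> {subset s <= J} -> {subset ideal_gen s <= J}.
Proof.
move=> Jc; elim: s => [|x s IH] sJ y; first by rewrite ideal_gen0 => /eqP->; exact: ideal0.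
case/ideal_gen_consP=> c [z [zs ->]]; apply: idealD => //.
  by apply: idealMl => //; apply: sJ; exact: mem_head.
by apply: IH zs => u us; apply: sJ; rewrite in_cons us orbT.
Qed.

Lemma ideal_gen_le s t : {subset s <= t} -> {subset ideal_gen s <= ideal_gen t}.
Proof.
move=> st; apply: ideal_gen_sub; first exact: ideal_gen_closed.
by move=> x /st; exact: mem_ideal_gen.
Qed.

Lemma ideal_gen_seq J s : ideal_closed J -> J =i ideal_gen s -> {subset s <= J}.
Proof. by move=> Jc JE x xs; rewrite JE mem_ideal_gen. Qed.

End Generators.

(** Otherwise choice gives a strictly increasing sequence in [P]; its union is finitely generated,
    hence reached at a finite stage. *)
Lemma noetherian_max (R : comNzRingType) (P : {pred R} -> Prop) :
  noetherian R -> (forall J, P J -> ideal_closed J) -> (exists J, P J) ->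
  exists2 J, P J & forall K, P K -> {subset J <= K} -> K = J.
Proof.
move=> Rn Pc [J0 PJ0]; apply: contrapT => nmax.
pose T := {J : {pred R} | P J}.
have step (t : T) : exists u : T, {subset sval t <= sval u} /\ sval u <> sval t.
  apply: contrapT => nstep; apply: nmax; exists (sval t); first exact: svalP.
  move=> K PK tK; apply: contrapT => Kt; apply: nstep.
  by exists (exist _ K PK).
pose next t := sval (cid (step t)).
pose C n := sval (iter n next (exist _ J0 PJ0)).
have Cc n : ideal_closed (C n) by apply: Pc; exact: svalP.
have CS n : {subset C n <= C n.+1} by exact: (svalP (cid (step _))).1.
have Cneq n : C n.+1 <> C n by exact: (svalP (cid (step _))).2.
have Cle n k : (n <= k)%N -> {subset C n <= C k}.
  by elim: k => [|k IH]; [rewrite leqn0 => /eqP->|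
     rewrite leq_eqVlt => /orP[/eqP->//|/IH nk x /nk/CS]].
pose U : {pred R} := [pred x | `[< exists n, x \in C n >]].
have Uc : ideal_closed U.
  split; first by apply/asboolP; exists 0%N; apply: ideal0.
  move=> a u v /asboolP[n un] /asboolP[k vk]; apply/asboolP; exists (maxn n k).
  apply: idealD; first exact: Cc.
    by apply: idealMl; [exact: Cc|apply: Cle un; exact: leq_maxl].
  by apply: Cle vk; exact: leq_maxr.
have [s UE] := Rn _ Uc.
have [n sn] : exists n, {subset s <= C n}.
  have : {subset s <= U} by exact: ideal_gen_seq.
  elim: s {UE} => [|x s IH] sU; first by exists 0%N.
  have /asboolP[n xn] := sU x (mem_head _ _).
  have [|k sk] := IH; first by move=> y ys; apply: sU; rewrite in_cons ys orbT.
  exists (maxn n k) => y; rewrite in_cons => /orP[/eqP->|/sk yk].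
    by apply: Cle xn; exact: leq_maxl.
  by apply: Cle yk; exact: leq_maxr.
apply: (Cneq n); apply: eq_ideal => // x xn.
apply: (ideal_gen_sub (Cc n) sn); rewrite -UE; apply/asboolP.
by exists n.+1.
Qed.

(** * Hilbert's basis theorem *)

Section HilbertBasis.
Variable R : comNzRingType.
Implicit Types (J : {pred {poly R}}) (p q : {poly R}).

Definition coef_ideal J n : {pred R} :=
  [pred c | `[< exists p, [/\ p \in J, (size p <= n.+1)%N & p`_n = c] >]].

Lemma coef_ideal_closed J n : ideal_closed J -> ideal_closed (coef_ideal J n).
Proof.
move=> Jc; split.
  by apply/asboolP; exists 0; rewrite ideal0 // size_poly0 coef0.
move=> a _ _ /asboolP[p [pJ szp <-]] /asboolP[q [qJ szq <-]].
apply/asboolP; exists (a%:P * p + q); split.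
- by apply: idealD => //; exact: idealMl.
- rewrite (leq_trans (size_polyD _ _)) // geq_max szq andbT.
  by rewrite mul_polyC (leq_trans (size_scale_leq _ _)).
- by rewrite coefD coefCM.
Qed.

Lemma coef_ideal_gen (S : seq {poly R}) n k c :
  {in S, forall p, (size p <= n.+1)%N} -> (n <= k)%N ->
  c \in ideal_gen [seq p`_n | p : {poly R} <- S] ->
  exists q, [/\ q \in ideal_gen S, (size q <= k.+1)%N & q`_k = c].
Proof.
move=> + le_nk; elim: S c => [|p S IH] c szS /=.
  rewrite ideal_gen0 => /eqP->; exists 0; rewrite size_poly0 coef0; split=> //.
  by rewrite ideal_gen0.
case/ideal_gen_consP=> d [z [zS ->]].
have [|q [qS szq <-]] := IH z _ zS.
  by move=> u uS; apply: szS; rewrite in_cons uS orbT.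
have szp := szS _ (mem_head _ _).
exists (d%:P * 'X^(k - n) * p + q); split.
- by apply/ideal_gen_consP; exists (d%:P * 'X^(k - n)), q.
- rewrite (leq_trans (size_polyD _ _)) // geq_max szq andbT -mulrA mul_polyC.
  rewrite (leq_trans (size_scale_leq _ _)) // (leq_trans (size_polyMleq _ _)) //.
  rewrite size_polyXn /=; move: (size p) szp le_nk => j; lia.
- rewrite coefD -mulrA coefCM coefXnM ltnNge leq_subr /=.
  by rewrite subKn.
Qed.

(** The ideals of leading coefficients in degree [n] grow with [n], and their union [L] is already
    reached in some degree [d]. Lifts of generators for the degrees up to [d] generate [J], by
    induction on the degree. *)
Lemma noetherian_poly : noetherian R -> noetherian {poly R}.
Proof.
move=> Rn J Jc.
have ex_S n : exists S : seq {poly R},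
    [/\ {subset S <= J}, {in S, forall p, (size p <= n.+1)%N}
      & {subset coef_ideal J n <= ideal_gen [seq p`_n | p : {poly R} <- S]}].
  have [s sE] := Rn _ (coef_ideal_closed n Jc).
  have sJ := ideal_gen_seq (coef_ideal_closed n Jc) sE.
  suff [S [SJ szS smap]] : exists S : seq {poly R},
      [/\ {subset S <= J}, {in S, forall p, (size p <= n.+1)%N}
        & s = [seq p`_n | p : {poly R} <- S]].
    by exists S; split=> // c; rewrite sE smap.
  elim: s sJ {sE} => [|c s IH] sJ; first by exists [::].
  have /asboolP[p [pJ szp pE]] := sJ c (mem_head _ _).
  have [|S [SJ szS sE]] := IH.
    by move=> u us; apply: sJ; rewrite in_cons us orbT.
  exists (p :: S); split=> [q|q|]; last by rewrite /= -sE pE.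
    by rewrite in_cons => /orP[/eqP->|/SJ].
  by rewrite in_cons => /orP[/eqP->|/szS].
have [S SP] := choice ex_S.
pose L : {pred R} := [pred c | `[< exists n, c \in coef_ideal J n >]].
have coefS n k : (n <= k)%N -> {subset coef_ideal J n <= coef_ideal J k}.
  move=> le_nk c /asboolP[p [pJ szp <-]]; apply/asboolP.
  exists ('X^(k - n) * p); split; first exact: idealMl.
    rewrite (leq_trans (size_polyMleq _ _)) //.
    by rewrite size_polyXn /=; move: (size p) szp le_nk => j; lia.
  by rewrite coefXnM ltnNge leq_subr /= subKn.
have Lc : ideal_closed L.
  split; first by apply/asboolP; exists 0%N; exact/ideal0/coef_ideal_closed.
  move=> a u v /asboolP[n un] /asboolP[k vk]; apply/asboolP; exists (maxn n k).
  apply: idealD; first exact: coef_ideal_closed.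
    apply: idealMl; first exact: coef_ideal_closed.
    by apply: coefS un; exact: leq_maxl.
  by apply: coefS vk; exact: leq_maxr.
have [s LE] := Rn _ Lc.
have [d Ld] : exists d, {subset L <= coef_ideal J d}.
  suff [d sd] : exists d, {subset s <= coef_ideal J d}.
    exists d => c; rewrite LE; apply: ideal_gen_sub sd _.
    exact: coef_ideal_closed.
  have := ideal_gen_seq Lc LE; elim: s {LE} => [|c s IH] sL; first by exists 0%N.
  have /asboolP[n cn] := sL c (mem_head _ _).
  have [|k sk] := IH; first by move=> u us; apply: sL; rewrite in_cons us orbT.
  exists (maxn n k) => u; rewrite in_cons => /orP[/eqP->|/sk uk].
    by apply: coefS cn; exact: leq_maxl.
  by apply: coefS uk; exact: leq_maxr.
exists (flatten [seq S n | n <- iota 0 d.+1]) => p; apply/idP/idP; last first.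
  apply: ideal_gen_sub => // q /flattenP[_ /mapP[n _ ->]].
  by case: (SP n) => SJ _ _; exact: SJ.
set G := flatten _; have Gc := ideal_gen_closed G.
have SG n : (n <= d)%N -> {subset ideal_gen (S n) <= ideal_gen G}.
  move=> le_nd; apply: ideal_gen_le => q qS; apply/flattenP; exists (S n) => //.
  by apply: map_f; rewrite mem_iota /= add0n ltnS.
have [k] := ubnP (size p); elim: k p => // k IH p szp pJ.
have [p0|p_neq0] := eqVneq p 0; first by rewrite p0 ideal0.
have szp_gt0 : (0 < size p)%N by rewrite size_poly_gt0.
pose n := (size p).-1; have szpE : size p = n.+1 by rewrite prednK.
(* [q] cancels the leading term of [p]; it comes from the generators of degree [minn n d], shifted
   up to degree [n]. *)
have [q [qG qJ szq qn]] : exists q, [/\ q \in ideal_gen G, q \in J,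
    (size q <= n.+1)%N & q`_n = p`_n].
  have pn : p`_n \in coef_ideal J n by apply/asboolP; exists p; rewrite szpE.
  pose i := minn n d; have [SJ szS Sgen] := SP i.
  have pi : p`_n \in ideal_gen [seq q`_i | q : {poly R} <- S i].
    apply: Sgen; rewrite /i; case: (leqP n d) => // _; apply: Ld.
    by apply/asboolP; exists n.
  have [q [qS szq qn]] := coef_ideal_gen szS (geq_minl n d) pi.
  exists q; split=> //; first by apply: SG qS; exact: geq_minr.
  exact: ideal_gen_sub SJ _ qS.
rewrite -[p](subrK q); apply: idealD => //; apply: IH; last exact: idealB.
apply: leq_trans (_ : n.+1 <= k)%N; last by rewrite -szpE.
rewrite ltnS; apply/leq_sizeP => j; rewrite leq_eqVlt => /orP[/eqP<-|lt_nj].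
  by rewrite coefB qn subrr.
by rewrite coefB !nth_default ?subrr // ?szpE // (leq_trans szq).
Qed.

End HilbertBasis.

Lemma noetherian_image (R T : comNzRingType) (f : {rmorphism R -> T}) :
  (forall t, exists r, f r = t) -> noetherian R -> noetherian T.
Proof.
move=> f_surj Rn J Jc; pose K : {pred R} := [pred r | f r \in J].
have Kc : ideal_closed K.
  split; first by rewrite inE rmorph0 ideal0.
  move=> a u v uK vK; rewrite inE rmorphD rmorphM.
  by apply: idealD => //; exact: idealMl.
have [s KE] := Rn _ Kc; exists (map f s) => t.
have [r <-] := f_surj t; apply/idP/idP => [rJ|]; last first.
  apply: ideal_gen_sub => // _ /mapP[x xs ->].
  exact: (ideal_gen_seq Kc KE xs).
have : r \in ideal_gen s by rewrite -KE.
move: r {rJ}; elim: s {KE} => [|x s IH] r.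
  by rewrite !ideal_gen0 => /eqP->; rewrite rmorph0.
case/ideal_gen_consP=> c [z [zs ->]]; apply/ideal_gen_consP.
by exists (f c), (f z); rewrite rmorphD rmorphM; split=> //; exact: IH.
Qed.

(** [R'] is an iterated polynomial ring with one variable for each element of [s], so that an
    algebra generated by [s] becomes an image of a noetherian ring. *)
Lemma noetherian_adjoin (R T : comNzRingType) (f : {rmorphism R -> T})
    (s : seq T) : noetherian R ->
  exists (R' : comNzRingType) (g : {rmorphism R' -> T}),
    [/\ noetherian R', forall r, exists r', g r' = f r
      & forall t, t \in s -> exists r', g r' = t].
Proof.
move=> Rn; elim: s => [|t s [R' [g [R'n gf gs]]]].
  by exists R, f; split=> // r; exists r.
have cgt : commr_rmorph g t by move=> x; exact: mulrC.
exists {poly R'}, (horner_morph cgt); split.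
- exact: noetherian_poly.
- by move=> r; have [r' <-] := gf r; exists r'%:P; exact: horner_morphC.
- move=> u; rewrite in_cons => /orP[/eqP->|/gs[r' <-]].
    by exists 'X; exact: horner_morphX.
  by exists r'%:P; exact: horner_morphC.
Qed.

(** * Maximal associated primes and generic nonzerodivisors *)

Section GenericNonzerodivisor.
Variables (R : comNzRingType) (q : {pred R}).
Hypotheses (R_noetherian : noetherian R) (q_closed : ideal_closed q).
Implicit Types (x y z c f : R) (s : seq R).

(** The ideals [ideal_colon q z] with such [z] are the maximal associated primes of [R / q]. *)
Definition maximal_annihilator z : Prop :=
  z \notin q /\ forall y, y \notin q ->
    {subset ideal_colon q z <= ideal_colon q y} ->
    ideal_colon q y = ideal_colon q z.

Lemma maximal_annihilator_prime z x y : maximal_annihilator z ->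
  x * y \in ideal_colon q z -> x \in ideal_colon q z \/ y \in ideal_colon q z.
Proof.
move=> [zq zmax] xyz; have [xz|xz] := boolP (x \in ideal_colon q z); first by left.
right; rewrite -(zmax (z * x)) //; first by move: xyz; rewrite !inE mulrA.
by move=> u; rewrite !inE => zu; rewrite mulrAC; exact: idealMr.
Qed.

Lemma maximal_annihilator_exists y : y \notin q ->
  exists2 z, maximal_annihilator z & {subset ideal_colon q y <= ideal_colon q z}.
Proof.
move=> yq.
pose P J := exists z, [/\ z \notin q, J = ideal_colon q z
                         & {subset ideal_colon q y <= J}].
have [||J [z [zq -> yz]] Jmax] := @noetherian_max _ P R_noetherian.
- by move=> J [z [_ -> _]]; exact: ideal_colon_closed.
- by exists (ideal_colon q y), y; split.
exists z => //; split=> // w wq zw; apply: Jmax => //.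
by exists w; split=> // u /yz /zw.
Qed.

(** By noetherianity some finite [s] generates, modulo [q], every such [z]. If no annihilator of an
    element of [s] were contained in that of [z], primality would give a multiplier killing [s] but
    not [z]. *)
Lemma finite_maximal_annihilators : exists2 s : seq R,
  (forall z, z \in s -> maximal_annihilator z) &
  forall z, maximal_annihilator z ->
    exists2 y, y \in s & ideal_colon q y = ideal_colon q z.
Proof.
pose P J := exists2 s : seq R, (forall z, z \in s -> maximal_annihilator z)
  & J = ideal_add q (ideal_gen s).
have addc s := ideal_add_closed q_closed (ideal_gen_closed s).
have [||J [s smax JE] Jmax] := @noetherian_max _ P R_noetherian.
- by move=> J [s _ ->].
- by exists (ideal_add q (ideal_gen [::])); exists [::].
exists s => // z zmax.
suff [y ys yz] : exists2 y, y \in s & {subset ideal_colon q y <= ideal_colon q z}.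
  by exists y => //; apply/esym/(smax y ys).2 => //; exact: zmax.1.
have /ideal_addP[u [v [uq vs zE]]] : z \in ideal_add q (ideal_gen s).
  rewrite -JE -(Jmax (ideal_add q (ideal_gen (z :: s)))).
  - by apply: mem_ideal_addr => //; apply: mem_ideal_gen; exact: mem_head.
  - exists (z :: s) => // w; rewrite in_cons => /orP[/eqP-> //|]; exact: smax.
  - rewrite JE; apply: ideal_add_sub => // w wq.
      by apply: mem_ideal_addl => //; exact: ideal_gen_closed.
    apply: mem_ideal_addr => //; apply: ideal_gen_le wq => t ts.
    by rewrite in_cons ts orbT.
apply: contrapT => nsub.
have [r rz rs] : exists2 r, r \notin ideal_colon q z &
    {in s, forall y, r * y \in q}.
  have : {subset s <= s} by [].
  elim: {1 3}s => [|y t IH] ts.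
    by exists 1 => //; rewrite inE mulr1; exact: zmax.1.
  have [|r rz rt] := IH; first by move=> w wt; apply: ts; rewrite in_cons wt orbT.
  have /existsNP[w /not_implyP[wy /negP wz]] :
      ~ {subset ideal_colon q y <= ideal_colon q z}.
    by move=> yz; apply: nsub; exists y => //; apply: ts; exact: mem_head.
  exists (r * w).
    apply/negP => /(maximal_annihilator_prime zmax)[]; apply/negP => //.
  move=> t'; rewrite in_cons => /orP[/eqP->|/rt t'q].
    by rewrite -mulrA (mulrC w); apply: idealMl.
  by rewrite mulrAC; exact: idealMr.
case/negP: rz; rewrite inE zE mulrDl; apply: idealD => //.
  exact: idealMr.
rewrite mulrC; apply: (ideal_gen_sub (ideal_colon_closed r q_closed) rs) vs.
Qed.

Variable lam : nat -> R.
Hypothesis lam_unit : forall i j, i != j -> exists u, u * (lam i - lam j) = 1.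

(* Two values of [lam] cannot be bad for the same prime. *)
Lemma pencil_avoidance s c f : (forall z, z \in s -> maximal_annihilator z) ->
  exists i, {in s, forall z, c + lam i * f \in ideal_colon q z ->
               c \in ideal_colon q z /\ f \in ideal_colon q z}.
Proof.
move=> smax; suff [B le_B] : exists B, forall i, (B <= i)%N ->
    {in s, forall z, c + lam i * f \in ideal_colon q z ->
       c \in ideal_colon q z /\ f \in ideal_colon q z}.
  by exists B; exact: le_B.
elim: s smax => [|z s IH] smax; first by exists 0%N.
have [|B le_B] := IH; first by move=> w ws; apply: smax; rewrite in_cons ws orbT.
have zc := ideal_colon_closed z q_closed.
have [[i0 i0z]|noi] := pselect (exists i0, c + lam i0 * f \in ideal_colon q z);
    last first.
  exists B => i /le_B iB w; rewrite in_cons => /orP[/eqP->|/iB//].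
  by move=> iz; case: noi; exists i.
exists (maxn B i0.+1) => i; rewrite geq_max => /andP[/le_B iB lt_i] w.
rewrite in_cons => /orP[/eqP-> iz|/iB//].
have [|u uE] := @lam_unit i i0; first by rewrite neq_ltn lt_i orbT.
have fz : f \in ideal_colon q z.
  have -> : f = u * ((c + lam i * f) - (c + lam i0 * f)).
    by rewrite -[LHS]mul1r -uE; ring.
  by apply: idealMl => //; exact: idealB.
by split=> //; move: iz; rewrite idealDr //; exact: idealMl.
Qed.

(** The elements of [fs] are added one by one with coefficients [lam i] chosen so that a maximal
    associated prime containing the sum contains all of them, which the first hypothesis forbids.
    [D] keeps track of the shape of the sum. *)
Lemma generic_nonzerodivisor (fs : seq R) (D : R -> Prop) :
  (forall z, {in fs, forall f, f * z \in q} -> z \in q) ->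
  D 0 -> (forall c f i, D c -> f \in fs -> D (c + lam i * f)) ->
  exists2 c, D c & forall z, c * z \in q -> z \in q.
Proof.
move=> fsq D0 DS; have [s smax allmax] := finite_maximal_annihilators.
have [c Dc cfs] : exists2 c, D c & forall z, z \in s -> c \in ideal_colon q z ->
    {subset fs <= ideal_colon q z}.
  have : {subset fs <= fs} by [].
  elim: {1 3}fs => [|f t IH] tfs; first by exists 0.
  have [|c Dc cs] := IH; first by move=> w wt; apply: tfs; rewrite in_cons wt orbT.
  have [i ci] := pencil_avoidance c f smax; exists (c + lam i * f).
    by apply: DS => //; apply: tfs; exact: mem_head.
  move=> z zs /(ci z zs)[cz fz] w; rewrite in_cons => /orP[/eqP-> //|].
  exact: cs cz w.
exists c => // z czq; apply: contrapT => /negP/maximal_annihilator_exists.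
case=> y /allmax[w ws <-] zw; have [wq _] := smax w ws.
have cw : c \in ideal_colon q w by apply: zw; rewrite inE mulrC.
by case/negP: wq; apply: fsq => f /(cfs w ws cw); rewrite inE mulrC.
Qed.

End GenericNonzerodivisor.

(** * The Rees algebra *)

Section Rees.
Variables (R : comNzRingType) (I : idealr R).
Implicit Types (x y : R) (P Q : rees I) (n : nat).

Lemma rees_coef P n : (rees_val P)`_n \in ideal_exp I n.
Proof. by have /asboolP := valP P. Qed.

Fact rees_const_subproof x : x%:P \in rees_pred I.
Proof.
apply/asboolP => -[|n]; rewrite coefC; first by [].
exact: ideal_exp0.
Qed.

Definition rees_const x : rees I := Rees (rees_const_subproof x).

Fact rees_const_is_zmod_morphism : zmod_morphism rees_const.
Proof. by move=> x y; apply: val_inj; rewrite /= polyCB. Qed.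

Fact rees_const_is_monoid_morphism : monoid_morphism rees_const.
Proof. by split; [|move=> x y]; apply: val_inj; rewrite //= polyCM. Qed.

HB.instance Definition _ :=
  GRing.isZmodMorphism.Build R (rees I) rees_const rees_const_is_zmod_morphism.
HB.instance Definition _ :=
  GRing.isMonoidMorphism.Build R (rees I) rees_const rees_const_is_monoid_morphism.

(* [0] unless [x] belongs to [I ^ n] *)
Definition rees_mono n x : rees I := insubd 0 (x *: 'X^n).

Lemma rees_monoE n x : x \in ideal_exp I n -> rees_val (rees_mono n x) = x *: 'X^n.
Proof.
move=> xI; rewrite /rees_mono insubdK //; apply/asboolP => i.
rewrite coefZ coefXn; case: eqP => [->|_]; first by rewrite mulr1.
by rewrite mulr0 ideal_exp0.
Qed.

Lemma coef_rees_monoM n x P i : x \in ideal_exp I n ->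
  (rees_val (rees_mono n x * P))`_i =
  if (i < n)%N then 0 else x * (rees_val P)`_(i - n).
Proof.
move=> xI; rewrite /= rees_monoE // -scalerAl coefZ coefXnM.
by case: ifP; rewrite ?mulr0.
Qed.

Lemma rees_monoM i j x y : x \in ideal_exp I i -> y \in ideal_exp I j ->
  rees_mono (i + j) (x * y) = rees_mono i x * rees_mono j y.
Proof.
move=> xI yI; apply: val_inj; rewrite /= !rees_monoE ?ideal_expM //.
by rewrite -scalerAl -scalerAr scalerA exprD.
Qed.

Lemma rees_monoD n x y : x \in ideal_exp I n -> y \in ideal_exp I n ->
  rees_mono n (x + y) = rees_mono n x + rees_mono n y.
Proof.
by move=> xI yI; apply: val_inj; rewrite /= !rees_monoE ?ideal_expD // scalerDl.
Qed.

Lemma rees_mono0 n : rees_mono n 0 = 0.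
Proof. by apply: val_inj; rewrite /= rees_monoE ?ideal_exp0 // scale0r. Qed.

Lemma rees_sumE P :
  P = \sum_(i < size (rees_val P)) rees_mono i (rees_val P)`_i.
Proof.
apply: val_inj; rewrite /= -[LHS]coefK poly_def.
rewrite (big_morph (@rees_val R I) (id1 := 0) (op1 := +%R)) //.
by apply: eq_bigr => i _; rewrite rees_monoE // rees_coef.
Qed.

(** The Rees algebra is generated over [R] by the monomials [f t] with [f] among finitely many
    generators of [I]. *)
Lemma rees_noetherian : noetherian R -> noetherian (rees I).
Proof.
move=> Rn; have [fs IE] := Rn I (idealr_ideal_closed I).
have [R' [g [R'n gc gs]]] :=
  noetherian_adjoin rees_const [seq rees_mono 1 f | f <- fs] Rn.
apply: (noetherian_image (f := g)) => //.
pose im P := exists r, g r = P.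
have imD P Q : im P -> im Q -> im (P + Q).
  by move=> [r <-] [t <-]; exists (r + t); rewrite rmorphD.
have imM P Q : im P -> im Q -> im (P * Q).
  by move=> [r <-] [t <-]; exists (r * t); rewrite rmorphM.
have im0 : im 0 by exists 0; rewrite rmorph0.
have I1 x : x \in I -> x \in ideal_exp I 1.
  move=> xI; apply/asboolP; exists [:: (x, 1)]; rewrite big_seq1 mulr1.
  by split=> // u; rewrite inE => /eqP->; rewrite /= xI.
have fsI : {subset fs <= I}.
  exact: ideal_gen_seq (idealr_ideal_closed I) IE.
have im1 x : x \in I -> im (rees_mono 1 x).
  rewrite IE; have : {subset fs <= fs} by [].
  elim: {1 3}fs x => [|f t IH] x tfs.
    by rewrite ideal_gen0 => /eqP->; rewrite rees_mono0.
  case/ideal_gen_consP=> c [z [zt ->]].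
  have tfs' : {subset t <= fs} by move=> w wt; apply: tfs; rewrite in_cons wt orbT.
  have fI : f \in I by apply: fsI; apply: tfs; exact: mem_head.
  have zI : z \in I by rewrite IE; exact: ideal_gen_le tfs' _ zt.
  have cfI : c * f \in I by apply: idealMl => //; exact: idealr_ideal_closed.
  rewrite rees_monoD ?I1 //; apply: imD; last exact: IH.
  have -> : rees_mono 1 (c * f) = rees_const c * rees_mono 1 f.
    apply: val_inj; rewrite /= !rees_monoE ?I1 //.
    by rewrite mul_polyC scalerA.
  apply: imM; first exact: gc.
  by apply: gs; apply: map_f; apply: tfs; exact: mem_head.
have imn n x : x \in ideal_exp I n -> im (rees_mono n x).
  elim: n x => [|n IH] x xI.
    have -> : rees_mono 0 x = rees_const x.
      by apply: val_inj; rewrite /= rees_monoE //= expr0 alg_polyC.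
    exact: gc.
  case/asboolP: xI => s [sP ->]; elim: s sP => [|u s IHs] sP.
    by rewrite big_nil rees_mono0.
  have /andP[u1 u2] := sP u (mem_head _ _).
  have sP' : {in s, forall u, (u.1 \in I) && (u.2 \in ideal_exp I n)}.
    by move=> w ws; apply: sP; rewrite in_cons ws orbT.
  have u12 : u.1 * u.2 \in ideal_exp I n.+1 by apply: (@ideal_expM _ _ 1 n) => //; exact: I1.
  rewrite big_cons rees_monoD //; last by apply/asboolP; exists s.
  apply: imD; last exact: IHs.
  by rewrite -add1n rees_monoM ?I1 //; apply: imM; [exact: im1|exact: IH].
move=> P; rewrite [P]rees_sumE; apply: (big_ind im) => // i _.
by apply: imn; exact: rees_coef.
Qed.

End Rees.

(** * The determinant trick *)

Section Products.
Variables (R : comNzRingType) (I : idealr R).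
Implicit Types (J K N W : {pred R}) (x y : R) (s : seq R).

Lemma ideal_mulP J K y :
  reflect (exists s : seq (R * R),
             {in s, forall u, (u.1 \in J) && (u.2 \in K)} /\
             y = \sum_(u <- s) u.1 * u.2)
          (y \in ideal_mul J K).
Proof. exact: asboolP. Qed.

Lemma mem_ideal_mul J K x y : x \in J -> y \in K -> x * y \in ideal_mul J K.
Proof.
move=> xJ yK; apply/ideal_mulP; exists [:: (x, y)]; rewrite big_seq1.
by split=> // u; rewrite inE => /eqP->; rewrite xJ yK.
Qed.

Lemma ideal_mul_sub J K L : ideal_closed L ->
  (forall x y, x \in J -> y \in K -> x * y \in L) -> {subset ideal_mul J K <= L}.
Proof.
move=> Lc JKL _ /ideal_mulP[s [sP ->]]; apply: ideal_sum => // u /sP/andP[uJ uK].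
exact: JKL.
Qed.

Lemma ideal_mulS J K J' K' : {subset J <= J'} -> {subset K <= K'} ->
  {subset ideal_mul J K <= ideal_mul J' K'}.
Proof.
move=> JJ KK _ /ideal_mulP[s [sP ->]]; apply/ideal_mulP; exists s; split=> //.
by move=> u /sP/andP[u1 u2]; rewrite JJ ?KK.
Qed.

Lemma ideal_mul_gen J s y : ideal_closed J -> y \in ideal_mul J (ideal_gen s) ->
  exists2 c : 'I_(size s) -> R, forall j, c j \in J & y = \sum_j c j * s`_j.
Proof.
move=> Jc /ideal_mulP[t [tP ->]]; elim: t tP => [|u t IH] tP.
  exists (fun=> 0); first by move=> j; exact: ideal0.
  by rewrite big_nil big1 // => j _; rewrite mul0r.
have /andP[uJ /asboolP[d u2E]] := tP u (mem_head _ _).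
have [|c cJ cE] := IH; first by move=> w wt; apply: tP; rewrite in_cons wt orbT.
exists (fun j => u.1 * d j + c j).
  by move=> j; apply: idealD => //; exact: idealMr.
rewrite big_cons cE u2E mulr_sumr -big_split; apply: eq_bigr => j _.
by rewrite mulrDl mulrA.
Qed.

Lemma ideal_exp_le n k : (n <= k)%N -> {subset ideal_exp I k <= ideal_exp I n}.
Proof.
elim: k => [|k IH]; first by rewrite leqn0 => /eqP->.
by rewrite leq_eqVlt => /orP[/eqP->//|/IH kn x /ideal_expS_sub/kn].
Qed.

Lemma ideal_exp1E : ideal_exp I 1 = I.
Proof.
apply: eq_ideal => x; first exact: ideal_exp1.
by move=> xI; rewrite -[x]mulr1; exact: mem_ideal_mul.
Qed.

Lemma mem_ideal_expS n x y :
  x \in I -> y \in ideal_exp I n -> x * y \in ideal_exp I n.+1.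
Proof. exact: mem_ideal_mul. Qed.

(* [p] is homogeneous of degree at least [d] when the variable has degree 1 and
   [I ^ k] has degree [k]. *)
Definition poly_weight d (p : {poly R}) := forall k, p`_k \in ideal_exp I (d - k).

Lemma poly_weightM d e p q :
  poly_weight d p -> poly_weight e q -> poly_weight (d + e) (p * q).
Proof.
move=> pd qe k; rewrite coefM; apply: ideal_exp_sum => i _.
apply: ideal_exp_le (ideal_expM (pd i) (qe (k - i)%N)).
by have := ltn_ord i; lia.
Qed.

(** Entries of [X - M] have weight 1, so each product of [n] entries in the Leibniz expansion has
    weight [n]. *)
Lemma char_poly_weight n (M : 'M[R]_n) :
  (forall i j, M i j \in I) -> poly_weight n (char_poly M).
Proof.
move=> MI k; rewrite coef_sum; apply: ideal_exp_sum => s _.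
set sg := (-1) ^+ _.
have : poly_weight n (sg * \prod_i char_poly_mx M i (s i)); last exact.
rewrite -[n in poly_weight n]add0n; apply: poly_weightM => [i|].
  by rewrite sub0n.
suff wt (r : seq 'I_n) :
    poly_weight (size r) (\prod_(i <- r) char_poly_mx M i (s i)).
  by rewrite -[n in poly_weight n]card_ord cardE enumT; exact: wt.
elim: r => [|i r IH] /=; first by rewrite big_nil => j; rewrite sub0n.
rewrite big_cons -add1n; apply: poly_weightM => // -[|j].
  rewrite subn0 ideal_exp1E !mxE coefB coefMn coefX mul0rn sub0r coefC.
  by apply: idealN; [exact: idealr_ideal_closed|exact: MI].
by rewrite subSS sub0n.
Qed.

Lemma horner_char_poly n (M : 'M[R]_n) y : (char_poly M).[y] = \det (y%:M - M).
Proof.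
rewrite -horner_evalE -det_map_mx; congr (\det _); apply/matrixP => i j.
by rewrite !mxE /= /horner_eval hornerD hornerN hornerMn hornerX hornerC.
Qed.

(** Cramer's rule: the relations say that [y%:M - M] maps the column of the [g j] into [W], and the
    adjugate turns this matrix into its determinant. *)
Lemma char_poly_annihilates n (M : 'M[R]_n) y (g : 'I_n -> R) W :
  ideal_closed W -> (forall i, y * g i - \sum_j M i j * g j \in W) ->
  forall i, (char_poly M).[y] * g i \in W.
Proof.
move=> Wc gW i; rewrite horner_char_poly; set B := y%:M - M.
pose h := \col_j g j.
have -> : \det B * g i = (\adj B *m (B *m h)) i 0.
  by rewrite mulmxA mul_adj_mx mul_scalar_mx !mxE.
rewrite mxE; apply: ideal_sum => // j _; apply: idealMl => //.
rewrite mulmxBl mul_scalar_mx !mxE.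
by under eq_bigr do rewrite mxE; exact: gW.
Qed.

(** Input of the determinant trick: used with [x = 1] for Nakayama's lemma and with [W] zero for
    integral dependence. *)
Lemma ideal_mul_matrix N W s x : N =i ideal_gen s ->
  (forall y, y \in N -> exists2 w, w \in W & x * y - w \in ideal_mul I N) ->
  exists2 M : 'M_(size s), forall i j, M i j \in I &
    forall i : 'I_(size s), x * s`_i - \sum_j M i j * s`_j \in W.
Proof.
move=> NE xN.
have sub : {subset ideal_mul I N <= ideal_mul I (ideal_gen s)}.
  by apply: ideal_mulS => // y; rewrite NE.
have row (i : 'I_(size s)) : exists c : 'I_(size s) -> R,
    (forall j, c j \in I) /\ x * s`_i - \sum_j c j * s`_j \in W.
  have [|w wW /sub] := xN s`_i; first by rewrite NE mem_ideal_gen ?mem_nth.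
  case/(ideal_mul_gen (idealr_ideal_closed I))=> c cI cE; exists c; split=> //.
  by rewrite -cE subKr.
have [c cP] := choice row; exists (\matrix_(i, j) c i j) => [i j|i].
  by rewrite mxE; case: (cP i).
have [_] := cP i; congr (_ - _ \in W); apply: eq_bigr => j _.
by rewrite mxE.
Qed.

Lemma nakayama N W : noetherian R -> ideal_closed N -> ideal_closed W ->
  (forall x, x \in I -> exists u, u * (1 + x) = 1) ->
  {subset N <= ideal_add W (ideal_mul I N)} -> {subset N <= W}.
Proof.
move=> Rn Nc Wc I_rad NWI; have [s NE] := Rn _ Nc.
have [y yN|M MI sM] := @ideal_mul_matrix N W s 1 NE.
  have /ideal_addP[w [z [wW zI ->]]] := NWI y yN.
  by exists w; rewrite // mul1r (addrC w) addrK.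
have detW := char_poly_annihilates Wc sM.
(* The characteristic polynomial is monic with its other coefficients in [I], so its value at 1 is 1
   modulo [I]. *)
have [u uE] : exists u, u * (char_poly M).[1] = 1.
  have -> : (char_poly M).[1] = 1 + ((char_poly M).[1] - 1) by rewrite addrC subrK.
  apply: I_rad; have szp := size_char_poly M.
  rewrite (horner_coef_wide _ (eq_leq szp)) big_ord_recr /= expr1n mulr1.
  have /monicP := char_poly_monic M; rewrite lead_coefE szp /= => ->.
  rewrite addrK; apply: ideal_sum => [|i _]; first exact: idealr_ideal_closed.
  rewrite expr1n mulr1 -ideal_exp1E; apply: ideal_exp_le (char_poly_weight MI i).
  by rewrite subn_gt0.
have Ws : {subset s <= W}.
  move=> _ /(nthP 0)[i lti <-].
  have := detW (Ordinal lti); move/(idealMl u Wc).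
  by rewrite mulrA uE mul1r.
by move=> y; rewrite NE; exact: ideal_gen_sub.
Qed.

(** The characteristic polynomial of multiplication by [x] has a value at [x] that kills [N]; this
    value is 0 as [N] contains the nonzerodivisor [c], and [char_poly_weight] puts the coefficients
    in the right powers of [I]. *)
Lemma integral_of_ideal N x c : noetherian R -> ideal_closed N ->
  c \in N -> (forall t, c * t = 0 -> t = 0) ->
  (forall y, y \in N -> x * y \in ideal_mul I N) -> integral_over_ideal I x.
Proof.
move=> Rn Nc cN c_reg xN; have [s NE] := Rn _ Nc.
have Wc := @ideal_gen_closed R [::].
have [y yN|M MI sM] := @ideal_mul_matrix N (ideal_gen [::]) s x NE.
  by exists 0; [exact: ideal0 Wc|rewrite subr0 xN].
have detW := char_poly_annihilates Wc sM.
have p0 : (char_poly M).[x] = 0.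
  apply: c_reg; rewrite mulrC; apply/eqP; move: cN; rewrite NE => /asboolP[d ->].
  rewrite mulr_sumr big1 // => i _; have := detW i; rewrite ideal_gen0 mulrCA => /eqP->.
  by rewrite mulr0.
have szp := size_char_poly M; have lead : (char_poly M)`_(size s) = 1.
  by have /monicP := char_poly_monic M; rewrite lead_coefE szp.
exists (size s), (fun i => (char_poly M)`_(size s - i)); split.
(* Without generators the characteristic polynomial would be 1, and its root [x] would give
   [1 = 0]. *)
- case: (posnP (size s)) => // s0.
  have sz1 : (size (char_poly M) <= 1)%N by rewrite szp s0.
  have lead0 : (char_poly M)`_0 = 1 by rewrite -lead; congr (_`_ _); rewrite s0.
  move: p0; rewrite (size1_polyC sz1) hornerC lead0 => /eqP.
  by rewrite oner_eq0.
- move=> i /andP[_ le_is]; have := char_poly_weight MI (size s - i)%N.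
  by rewrite subKn.
- rewrite -[RHS]p0 (horner_coef_wide _ (eq_leq szp)) big_ord_recr /= lead mul1r.
  rewrite addrC; congr (_ + _); rewrite big_add1 /= -(big_mkord xpredT
    (fun i => (char_poly M)`_i * x ^+ i)) [RHS]big_nat_rev /=.
  by apply: eq_bigr => i _; rewrite add0n.
Qed.

End Products.

(** * Units in a local ring *)

Section LocalRing.
Variables (R : comNzRingType) (m : idealr R).
Hypotheses (R_local : local_ring m) (R_noetherian : noetherian R).

Lemma idealr_closed_ideal (J : {pred R}) :
  idealr_closed J <-> ideal_closed J /\ 1 \notin J.
Proof. by split=> [[J0 J1 JD]|[[J0 JD] J1]]; do ?split. Qed.

Lemma local_unit x : x \notin m -> exists u, u * x = 1.
Proof.
move=> xm; apply: contrapT => xu.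
pose P J := ideal_closed J /\ 1 \notin J /\ x \in J.
have [||J [Jc [J1 xJ]] Jmax] := @noetherian_max R P R_noetherian.
- by move=> J [].
- exists (principal x); split; first exact: principal_closed; split.
    by apply/principalP => -[u uE]; apply: xu; exists u; rewrite mulrC -uE.
  by apply/principalP; exists 1; rewrite mulr1.
have /R_local.2 Jm : maximal_ideal J.
  split; first exact/idealr_closed_ideal.
  move=> K /idealr_closed_ideal[Kc K1] JK y.
  by rewrite (Jmax K) //; split=> //; split=> //; exact: JK.
by case/negP: xm; rewrite -Jm.
Qed.

Lemma local_unit_addr x : x \in m -> exists u, u * (1 + x) = 1.
Proof.
move=> xm; apply: local_unit; apply/negP => x1m.
have := idealr1 m; rewrite -[1](addrK x) idealB //.
exact: idealr_ideal_closed.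
Qed.

(** Lifts of pairwise distinct residue classes: their differences lie outside [m]. *)
Lemma unit_differences : infinite_set [set: {ideal_quot m}] ->
  exists lam : nat -> R, forall i j, i != j -> exists u, u * (lam i - lam j) = 1.
Proof.
move/infiniteP/card_leP => -[f].
pose T i : set_type [set: nat] := exist _ i (in_setT i).
exists (fun i => repr (val (f (T i)))) => i j ij.
apply: local_unit; rewrite Quotient.idealrBE !reprK.
apply: contra_neqN ij => /eqP/val_inj fij.
have : T i = T j by apply: (inj (f := f)) => //; exact: in_setT.
by case.
Qed.

End LocalRing.

(** * Generic linear forms *)

Section GradedElements.
Variables (A : comNzRingType) (m I : idealr A).
Hypotheses (A_local : local_ring m) (A_noetherian : noetherian A).
Implicit Types (a b p x y : A) (P Q : rees I) (n s : nat).

Hint Resolve ideal_exp_closed idealr_ideal_closed : core.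

Lemma rees_shiftP Q :
  reflect (forall n, (rees_val Q)`_n \in ideal_exp I n.+1) (Q \in rees_shift I).
Proof. exact: asboolP. Qed.

Lemma rees_mono_shift n p : p \in ideal_exp I n ->
  (rees_mono I n p \in rees_shift I) = (p \in ideal_exp I n.+1).
Proof.
move=> pI; apply/rees_shiftP/idP => [/(_ n)|pI' i]; rewrite rees_monoE //.
  by rewrite coefZ coefXn eqxx mulr1.
rewrite coefZ coefXn; case: eqP => [->|_]; first by rewrite mulr1.
by rewrite mulr0 ideal_exp0.
Qed.

Lemma ideal_expS_gen (fs : seq A) n (L : {pred A}) : I =i ideal_gen fs ->
  ideal_closed L -> (forall f u, f \in fs -> u \in ideal_exp I n -> f * u \in L) ->
  {subset ideal_exp I n.+1 <= L}.
Proof.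
move=> IE Lc fsL; apply: ideal_mul_sub => // f u + uI; rewrite IE mulrC => fI.
apply: (ideal_gen_sub (ideal_colon_closed u Lc) _ fI) => g gfs.
by rewrite inE mulrC; exact: fsL.
Qed.

(* [g := P] is a nonzerodivisor of [G(I)]; if [p] is killed by [G(I)_1] then
   [g] acts on [p] as [P`_0], which is nilpotent in [G(I)]. *)
Lemma graded_torsion_free P n p : radical I =i m ->
  (rees_val P)`_0 \in m ->
  (forall Q, P * Q \in rees_shift I -> Q \in rees_shift I) ->
  p \in ideal_exp I n -> (forall x, x \in I -> x * p \in ideal_exp I n.+2) ->
  p \in ideal_exp I n.+1.
Proof.
move=> Im P0m Preg; have : (rees_val P)`_0 \in radical I by rewrite Im.
set c := (rees_val P)`_0 => /asboolP[s csI] pI Ip.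
have : c ^+ s * p \in ideal_exp I n.+1 by exact: mem_ideal_mul.
elim: s p pI Ip {csI} => [|s IH] p pI Ip; first by rewrite mul1r.
rewrite exprSr -mulrA => /(IH (c * p)) cpI.
(* It suffices that [P] kills the symbol of [p t^n]: in degree [n] this is the induction hypothesis
   for [c * p], in higher degrees it follows from the hypothesis on [I p]. *)
rewrite -rees_mono_shift //; apply: Preg; rewrite mulrC; apply/rees_shiftP => i.
rewrite coef_rees_monoM //; case: ltnP => [_|le_ni]; first exact: ideal_exp0.
rewrite -{2}(subnKC le_ni); move: (i - n)%N => k; case: k => [|k].
  rewrite addn0 mulrC; apply: cpI; first exact: idealMl.
  by move=> x xI; rewrite mulrCA; apply: idealMl => //; exact: Ip.
have -> : (n + k.+1).+1 = (n.+2 + k)%N by lia.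
have /ideal_mul_sub : forall x y, x \in I -> y \in ideal_exp I k ->
    x * y \in ideal_colon (ideal_exp I (n.+2 + k)) p.
  move=> x y xI yI; suff : x * p * y \in ideal_exp I (n.+2 + k) by rewrite !inE mulrCA mulrA.
  by apply: ideal_expM => //; exact: Ip.
move/(_ (ideal_colon_closed p (ideal_exp_closed _ _))).
by move/(_ (rees_val P)`_k.+1 (rees_coef P k.+1)); rewrite inE.
Qed.

Variable lam : nat -> A.
Hypothesis lam_unit : forall i j, i != j -> exists u, u * (lam i - lam j) = 1.

(** This is [generic_nonzerodivisor] in the Rees algebra, for the monomials [f t]; the coefficients
    are constants, so the sum is again of the form [c t]. *)
Lemma generic_linear_form (q : {pred rees I}) : ideal_closed q ->
  (forall Q, (forall x, x \in I -> rees_mono I 1 x * Q \in q) -> Q \in q) ->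
  exists2 c, c \in I & forall Q, rees_mono I 1 c * Q \in q -> Q \in q.
Proof.
move=> qc qreg; have [fs IE] := A_noetherian (idealr_ideal_closed I).
pose D (P : rees I) := exists2 x, x \in I & P = rees_mono I 1 x.
have lam_unit' i j : i != j ->
    exists u, u * (rees_const I (lam i) - rees_const I (lam j)) = 1.
  move=> /lam_unit[u uE]; exists (rees_const I u).
  by rewrite -rmorphB -rmorphM uE rmorph1.
have [|||_ [x xI ->] xreg] := @generic_nonzerodivisor _ q
    (@rees_noetherian _ I A_noetherian) qc _ lam_unit' [seq rees_mono I 1 f | f <- fs] D.
- move=> Q fsQ; apply: qreg => x; rewrite IE.
  pose K : {pred A} := [pred y | (y \in I) && (rees_mono I 1 y * Q \in q)].
  have Kc : ideal_closed K.
    split; first by rewrite inE rpred0 rees_mono0 mul0r ideal0.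
    move=> c u v; rewrite !inE => /andP[uI uQ] /andP[vI vQ].
    have cuI : c * u \in I by exact: idealMl.
    rewrite idealD //= rees_monoD ?ideal_exp1E //.
    have -> : rees_mono I 1 (c * u) = rees_const I c * rees_mono I 1 u.
      apply: val_inj; rewrite /= !rees_monoE ?ideal_exp1E //.
      by rewrite mul_polyC scalerA.
    by rewrite mulrDl; apply: idealD => //; rewrite -mulrA; exact: idealMl.
  move=> xfs; suff : x \in K by rewrite inE => /andP[].
  apply: ideal_gen_sub xfs => // f ffs; rewrite inE IE mem_ideal_gen //=.
  by apply: fsQ; exact: map_f.
- by exists 0; rewrite ?rpred0 // rees_mono0.
- move=> _ _ i [x xI ->] /mapP[f ffs ->].
  have fI : f \in I by rewrite IE mem_ideal_gen.
  have lfI : lam i * f \in I by exact: idealMl.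
  exists (x + lam i * f); first exact: idealD.
  rewrite rees_monoD ?ideal_exp1E //; congr (_ + _).
  apply: val_inj; rewrite /= !rees_monoE ?ideal_exp1E //.
  by rewrite mul_polyC scalerA.
by exists x.
Qed.

Lemma regular_linear_form :
  (forall n p, p \in ideal_exp I n -> (forall x, x \in I -> x * p \in ideal_exp I n.+2) ->
     p \in ideal_exp I n.+1) ->
  exists2 a, a \in I &
    forall n p, a * p \in ideal_exp I n.+1 -> p \in ideal_exp I n.
Proof.
move=> tf; have [Q IQ|a aI areg] :=
  generic_linear_form (idealr_ideal_closed (rees_shift I)).
  apply/rees_shiftP => n; apply: tf; first exact: rees_coef.
  move=> x xI; have /rees_shiftP/(_ n.+1) := IQ x xI.
  by rewrite coef_rees_monoM ?ideal_exp1E // subn1.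
have areg' n p : p \in ideal_exp I n -> a * p \in ideal_exp I n.+2 ->
    p \in ideal_exp I n.+1.
  move=> pI apI; rewrite -rees_mono_shift //; apply: areg.
  rewrite -rees_monoM ?ideal_exp1E // rees_mono_shift //.
  exact: mem_ideal_expS.
exists a => // n p apI.
(* The order of [p] is raised one step at a time, starting from [I ^ 0]. *)
suff H k : (k <= n)%N -> p \in ideal_exp I k by exact: H.
elim: k => // k IH lt_kn; apply: areg'; first exact/IH/ltnW.
exact: ideal_exp_le apI.
Qed.

(* Degree [n] part of the ideal of the Rees algebra generated by [I] and [a t]. *)
Definition mod_linear a n : {pred A} :=
  if n is n'.+1 then ideal_add (ideal_scale a (ideal_exp I n')) (ideal_exp I n.+1)
  else I.

Lemma mod_linear_closed a n : ideal_closed (mod_linear a n).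
Proof.
case: n => [|n]; rewrite /mod_linear //.
by apply: ideal_add_closed => //; exact: ideal_scale_closed.
Qed.

Lemma mod_linear_exp a n : {subset ideal_exp I n.+1 <= mod_linear a n}.
Proof.
case: n => [|n] x xI; first exact: ideal_exp1.
by apply: mem_ideal_addr => //; exact: ideal_scale_closed.
Qed.

Lemma mod_linearM a i j x y :
  x \in ideal_exp I i -> y \in mod_linear a j -> x * y \in mod_linear a (i + j).
Proof.
case: j => [|j] xI.
  rewrite addn0 => yI; apply: mod_linear_exp.
  by rewrite -addn1; apply: ideal_expM => //; rewrite ideal_exp1E.
move=> /ideal_addP[_ [v [/ideal_scaleP[u uI ->] vI ->]]]; rewrite addnS mulrDr.
apply/ideal_addP; exists (a * (x * u)), (x * v); split; last by ring.
  by apply: mem_ideal_scale; exact: ideal_expM.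
by rewrite -!addnS; exact: ideal_expM.
Qed.

(** [G(I) / (a t)] may have elements killed by all forms of large degree, so [b] is chosen regular
    modulo the saturation [qs] of the ideal [q] defining this quotient. As [qs] is finitely
    generated, it agrees with [q] in large degrees. *)
Lemma generic_linear_form_mod a :
  exists2 b, b \in I & exists n0, forall n p, (n0 <= n)%N ->
    p \in ideal_exp I n -> b * p \in mod_linear a n.+1 -> p \in mod_linear a n.
Proof.
pose N := mod_linear a; have Nc := mod_linear_closed a.
pose q : {pred rees I} := [pred Q | `[< forall n, (rees_val Q)`_n \in N n >]].
have qc : ideal_closed q.
  split; first by apply/asboolP => n; rewrite coef0; apply: ideal0.
  move=> P Q S /asboolP Qq /asboolP Sq; apply/asboolP => n.
  rewrite coefD; apply: idealD => //; rewrite coefM; apply: ideal_sum => // i _.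
  have := mod_linearM (rees_coef P i) (Qq (n - i)%N).
  by rewrite subnKC // -ltnS.
have mono_q n p : p \in ideal_exp I n -> p \in N n -> rees_mono I n p \in q.
  move=> pI pN; apply/asboolP => k; rewrite rees_monoE // coefZ coefXn.
  by case: eqP => [->|_]; [rewrite mulr1|rewrite mulr0; exact: ideal0].
pose qs : {pred rees I} := [pred Q | `[< exists s, forall i x, (s <= i)%N ->
  x \in ideal_exp I i -> rees_mono I i x * Q \in q >]].
have q_qs : {subset q <= qs}.
  by move=> Q Qq; apply/asboolP; exists 0%N => i x _ _; exact: idealMl.
have qsc : ideal_closed qs.
  split; first by apply: q_qs; exact: ideal0.
  move=> P Q S /asboolP[s Qs] /asboolP[t St]; apply/asboolP; exists (maxn s t).
  move=> i x; rewrite geq_max => /andP[si ti] xI; rewrite mulrDr mulrCA.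
  by apply: idealD => //; [apply: idealMl => //; exact: Qs|exact: St].
have [Q IQ|b bI breg] := generic_linear_form qsc.
  have [fs IE] := A_noetherian (idealr_ideal_closed I).
  (* One exponent serves all the generators of [I]; with one degree more, forms take [Q] itself into
     [q]. *)
  have [s sP] : exists s, forall f i x, f \in fs -> (s <= i)%N ->
      x \in ideal_exp I i -> rees_mono I i x * (rees_mono I 1 f * Q) \in q.
    have : {subset fs <= I} by exact: ideal_gen_seq.
    elim: fs {IE} => [|f fs IH] fsI; first by exists 0%N.
    have [|s sP] := IH; first by move=> g gs; apply: fsI; rewrite in_cons gs orbT.
    have /asboolP[t tP] := IQ f (fsI f (mem_head _ _)).
    exists (maxn s t) => g i x; rewrite in_cons geq_max => + /andP[si ti].
    by case/orP=> [/eqP->|gs] xI; [exact: tP|exact: sP].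
  apply/asboolP; exists s.+1 => -[|i] x //; rewrite ltnS => le_si.
  pose K : {pred A} := [pred y | (y \in ideal_exp I i.+1) &&
                                 (rees_mono I i.+1 y * Q \in q)].
  suff : {subset ideal_exp I i.+1 <= K} by move=> KI /KI/andP[].
  apply: (ideal_expS_gen IE) => [|f u ffs uI].
    split; first by apply/andP; rewrite ideal_exp0 rees_mono0 mul0r ideal0.
    move=> c v w /andP[vI vQ] /andP[wI wQ]; apply/andP.
    have cvI : c * v \in ideal_exp I i.+1 by exact: idealMl.
    split; first exact: idealD.
    rewrite rees_monoD //.
    have -> : rees_mono I i.+1 (c * v) = rees_const I c * rees_mono I i.+1 v.
      by apply: val_inj; rewrite /= !rees_monoE // mul_polyC scalerA.
    by rewrite mulrDl; apply: idealD => //; rewrite -mulrA; exact: idealMl.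
  have fI : f \in I by rewrite IE mem_ideal_gen.
  apply/andP; split; first exact: mem_ideal_expS.
  rewrite -add1n rees_monoM ?ideal_exp1E //.
  by rewrite -mulrA mulrCA; exact: sP.
exists b => //; have [Qs QsE] := @rees_noetherian _ I A_noetherian _ qsc.
suff [n0 n0P] : exists n0, forall Q n, Q \in qs -> (n0 <= n)%N -> (rees_val Q)`_n \in N n.
  exists n0 => n p le_n pI bpN.
  have <- : (rees_val (rees_mono I n p))`_n = p.
    by rewrite rees_monoE // coefZ coefXn eqxx mulr1.
  apply: n0P => //; apply: breg; apply: q_qs.
  rewrite -rees_monoM ?ideal_exp1E //; apply: mono_q => //.
  exact: mem_ideal_expS.
have : {subset Qs <= qs} by exact: ideal_gen_seq.
suff : {subset Qs <= qs} -> exists n0, forall Q n, Q \in ideal_gen Qs ->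
    (n0 <= n)%N -> (rees_val Q)`_n \in N n.
  by move=> H /H[n0 n0P]; exists n0 => Q n; rewrite QsE; exact: n0P.
elim: Qs {QsE} => [|Q Qs IH] Qs_qs.
  by exists 0%N => Q n; rewrite ideal_gen0 => /eqP-> _; rewrite coef0; exact: ideal0.
have [|n0 n0P] := IH; first by move=> S SQs; apply: Qs_qs; rewrite in_cons SQs orbT.
have /asboolP[s sP] := Qs_qs Q (mem_head _ _).
(* In such a degree [n], a term of [P * Q] either uses [P] in degree at least [s], which takes [Q]
   into [q], or a coefficient of [Q] beyond its size. *)
exists (maxn n0 (s + size (rees_val Q))) => S n /ideal_gen_consP[P [T [TQs ->]]].
rewrite geq_max => /andP[le_n0 le_n]; rewrite coefD; apply: idealD => //; last exact: n0P.
rewrite coefM; apply: ideal_sum => // i _; have [le_si|lt_is] := leqP s i; last first.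
  rewrite [(rees_val Q)`_ _]nth_default ?mulr0; first exact: ideal0.
  by move: le_n lt_is; move: (size _) => z; lia.
have := sP i _ le_si (rees_coef P i); move/asboolP/(_ n).
by rewrite coef_rees_monoM ?rees_coef // ltnNge -ltnS ltn_ord.
Qed.

End GradedElements.

(** * The reduction number *)

(** The increments of [f] increase to 0, so [f] is nonincreasing; hence [f] is nonnegative
    everywhere, and at most [f 1] from 1 on. *)
Lemma convex_eventually_zero (f : nat -> int) N :
  (forall n, f n.+1 + f n.+1 <= f n.+2 + f n)%R ->
  (forall n, (N <= n)%N -> f n = 0) -> f 1%N = 0 -> forall n, f n.+1 = 0.
Proof.
move=> f_convex f0 f1.
have dec k : (forall n, (N <= n + k)%N -> f n.+1 <= f n)%R.
  elim: k => [|k IH] n; first by rewrite addn0 => le_Nn; rewrite !f0 // leqW.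
  by move=> le_N; have := IH n.+1; rewrite addSnnS => /(_ le_N); have := f_convex n; lia.
have {}dec n : (f n.+1 <= f n)%R by apply: (dec N); exact: leq_addl.
have le0 n : (f n.+1 <= 0)%R.
  by elim: n => [|n IH]; [rewrite f1|have := dec n.+1; lia].
have ge0 k : forall n, (N <= n + k)%N -> (0 <= f n)%R.
  elim: k => [|k IH] n; first by rewrite addn0 => /f0->.
  by rewrite -addSnnS => /IH; have := dec n; lia.
by move=> n; have := le0 n; have := ge0 N n.+1 (leq_addl _ _); lia.
Qed.

Section Reduction.
Variables (A : comNzRingType) (m I : idealr A) (a b : A).
Hypotheses (A_local : local_ring m) (A_noetherian : noetherian A).
Hypotheses (I_sub : {subset I <= m}) (aI : a \in I) (bI : b \in I).
Implicit Types (J K N W : {pred A}) (n : nat).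

Notation H n := (colength (ideal_exp I n)).

Hint Resolve ideal_exp_closed idealr_ideal_closed mod_linear_closed : core.

(** The product [(a, b) K]; for [K := predT], the ideal [(a, b)] itself. *)
Definition two_generated K : {pred A} := ideal_add (ideal_scale a K) (ideal_scale b K).

Lemma two_generated_closed K : ideal_closed K -> ideal_closed (two_generated K).
Proof. by move=> Kc; apply: ideal_add_closed; exact: ideal_scale_closed. Qed.

Lemma two_generatedP K y :
  reflect (exists u v, [/\ u \in K, v \in K & y = a * u + b * v])
          (y \in two_generated K).
Proof.
apply: (iffP (ideal_addP _ _ _)).
  case=> _ [_ [/ideal_scaleP[u uK ->] /ideal_scaleP[v vK ->] ->]].
  by exists u, v.
case=> u [v [uK vK ->]]; exists (a * u), (b * v); split=> //.
  exact: mem_ideal_scale.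
exact: mem_ideal_scale.
Qed.

Lemma two_generatedS J K :
  {subset J <= K} -> {subset two_generated J <= two_generated K}.
Proof.
move=> JK _ /two_generatedP[u [v [/JK uK /JK vK ->]]].
by apply/two_generatedP; exists u, v.
Qed.

Lemma two_generated_exp n : {subset two_generated (ideal_exp I n) <= ideal_exp I n.+1}.
Proof.
move=> _ /two_generatedP[u [v [uI vI ->]]].
by apply: ideal_expD; exact: mem_ideal_expS.
Qed.

Hypothesis exp_finite : forall n, finite_colength (ideal_exp I n).

Lemma finite_colength_exp n W : {subset ideal_exp I n <= W} -> finite_colength W.
Proof. by move=> IW; apply: finite_colengthS (exp_finite n). Qed.

Hypothesis a_regular :
  forall n p, a * p \in ideal_exp I n.+1 -> p \in ideal_exp I n.

(** Multiplication by [a] maps [I ^ n / I ^ n.+1] isomorphically onto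
    [mod_linear I a n.+1 / I ^ n.+2]. *)
Lemma colength_mod_linear n :
  (H n.+1 + colength (mod_linear I a n.+1) = H n.+2 + H n)%N.
Proof.
have aE x : (a * x \in ideal_exp I n.+2) = (x \in ideal_exp I n.+1).
  by apply/idP/idP => [/a_regular|xI] //; exact: mem_ideal_expS.
apply: (@colength_iso _ _ _ _ _ a) => //.
- exact: ideal_expS_sub.
- exact: mod_linear_exp.
- move=> x xI; apply: mem_ideal_addl => //.
  exact: mem_ideal_scale.
Qed.

(** The last hypothesis is the vanishing of the third difference of [H]; by [colength_mod_linear]
    the pieces of [G(I) / (a)] then have constant length, which makes the injection [b] onto. *)
Lemma reduction_exists n0 n1 :
  (forall n p, (n0 <= n)%N -> p \in ideal_exp I n ->
     b * p \in mod_linear I a n.+1 -> p \in mod_linear I a n) ->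
  (forall n, (n1 <= n)%N -> H n.+3 + 3 * H n.+1 = 3 * H n.+2 + H n)%N ->
  exists r, forall n, (r <= n)%N ->
    {subset ideal_exp I n.+1 <= two_generated (ideal_exp I n)}.
Proof.
move=> b_regular H_quadratic; exists (maxn n0 n1).+1 => -[//|n].
rewrite ltnS geq_max => /andP[le_n0 le_n1].
pose N k := mod_linear I a k.+1.
have Nc k : ideal_closed (N k) by exact: mod_linear_closed.
have Nfin k : finite_colength (N k).
  by apply: (@finite_colength_exp k.+2); exact: mod_linear_exp.
have NI k : {subset N k <= ideal_exp I k.+1}.
  apply: ideal_add_sub => // [_ /ideal_scaleP[x xI ->]|]; last exact: ideal_expS_sub.
  exact: mem_ideal_expS.
pose K := ideal_add (ideal_scale b (ideal_exp I n.+1)) (N n.+1).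
have Kc : ideal_closed K by apply: ideal_add_closed => //; exact: ideal_scale_closed.
have KI : {subset K <= ideal_exp I n.+2}.
  apply: ideal_add_sub => // _ /ideal_scaleP[x xI ->].
  exact: mem_ideal_expS.
have bN x : x \in N n -> b * x \in N n.+1.
  by move=> xN; apply: (@mod_linearM _ _ _ 1) => //; rewrite ideal_exp1E.
have lenK : (colength (N n) + colength K = colength (N n.+1) + H n.+1)%N.
  apply: (@colength_iso _ _ _ _ _ b) => //.
  - by move=> x xN; apply: mem_ideal_addr => //; exact: ideal_scale_closed.
  - by move=> x xI; apply/idP/idP => [|/bN//]; apply: b_regular => //; exact: leqW.
  - move=> x xI; apply: mem_ideal_addl; first exact: mod_linear_closed.
    exact: mem_ideal_scale.
have KE : K = ideal_exp I n.+2.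
  apply: colength_eq => //.
    apply: (@finite_colength_exp n.+3) => x xI; apply: mem_ideal_addr.
      exact: ideal_scale_closed.
    exact: mod_linear_exp.
  have := colength_mod_linear n; have := colength_mod_linear n.+1.
  by have := H_quadratic n le_n1; move: lenK; rewrite /N; lia.
(* So far [I ^ n.+2] is [(a, b) I ^ n.+1 + I ^ n.+3]; the last term is [I] times [I ^ n.+2]. *)
apply: (nakayama (I := I)) => //.
- exact: two_generated_closed.
- by move=> x /I_sub; exact: local_unit_addr.
rewrite -KE => _ /ideal_addP[_ [v [/ideal_scaleP[y yI ->] vN ->]]].
case/ideal_addP: vN => _ [w [/ideal_scaleP[z zI ->] wI ->]].
apply/ideal_addP; exists (b * y + a * z), w; split; last by rewrite addrA.
  by apply/two_generatedP; exists z, y; split; rewrite // addrC.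
by rewrite KE.
Qed.

Hypothesis koszul : forall x y, a * x = b * y -> exists2 h, x = b * h & y = a * h.

(* The map [(A / I ^ n.+1) ^ 2 -> J / J I ^ n.+1] is onto, with kernel
   [A / (I ^ n.+1 : J) = A / I ^ n]; the four steps filter it in such a way that
   only quotients of ideals of [A] occur. *)
Lemma colength_two_generated r n :
  (forall k, (r <= k)%N -> {subset ideal_exp I k.+1 <= two_generated (ideal_exp I k)}) ->
  (colength (two_generated (ideal_exp I n.+1)) + H n =
   colength (two_generated predT) + H n.+1 + H n.+1)%N.
Proof.
move=> red; set K := ideal_exp I n.+1; pose C := ideal_colon K b.
have Kc : ideal_closed K by exact: ideal_exp_closed.
have Cc : ideal_closed C by exact: ideal_colon_closed.
have bc := ideal_scale_closed b (idealT A).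
have KC : {subset K <= C} by move=> x xK; apply: idealMl.
have nC : {subset ideal_exp I n <= C}.
  by move=> x xI; apply: mem_ideal_expS.
(* With [J := (a, b)], the four isomorphisms are [A / bK] to [J / bA] by [a], [A / aC] to [bA / J K]
   by [b], [A / C] to [bK / K] by [b], and [C / I ^ n] to [aC / K] by [a]. *)
pose bK := ideal_add (principal b) K.
pose bA := ideal_add (principal b) (ideal_scale a K).
pose aC := ideal_add (ideal_scale a C) K.
have bKc : ideal_closed bK by exact: ideal_add_closed.
have bAc : ideal_closed bA.
  by apply: ideal_add_closed => //; exact: ideal_scale_closed.
have aCc : ideal_closed aC.
  by apply: ideal_add_closed => //; exact: ideal_scale_closed.
have JKc : ideal_closed (two_generated K) by exact: two_generated_closed.
have Jc : ideal_closed (two_generated predT) by exact/two_generated_closed/idealT.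
have JKfin : finite_colength (two_generated K).
  pose k := maxn r n.+1; apply: (@finite_colength_exp k.+1) => x.
  move/(red _ (leq_maxl _ _)); apply: two_generatedS.
  exact: ideal_exp_le (leq_maxr _ _).
have bKfin : finite_colength bK.
  by apply: (@finite_colength_exp n.+1) => x xK; exact: mem_ideal_addr.
have aCfin : finite_colength aC.
  apply: (@finite_colength_exp n.+1) => x xK; apply: mem_ideal_addr => //.
  exact: ideal_scale_closed.
have Kfin : finite_colength K by exact: exp_finite.
have Cfin : finite_colength C by exact: finite_colength_exp KC.
have bAfin : finite_colength bA.
  apply: finite_colengthS JKfin => // _ /two_generatedP[u [v [uK _ ->]]].
  apply/ideal_addP; exists (b * v), (a * u); rewrite addrC; split=> //.
    by apply/principalP; exists v.
  exact: mem_ideal_scale.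
have step1 : (colength bK + colength (two_generated predT) = colength bA + 0)%N.
  rewrite -(colengthT A); apply: (@colength_iso _ _ _ _ _ a) => //.
  - apply: ideal_add_sub => // [_ /principalP[x ->]|_ /ideal_scaleP[x _ ->]].
      by apply/two_generatedP; exists 0, x; rewrite mulr0 add0r.
    by apply/two_generatedP; exists x, 0; rewrite mulr0 addr0.
  - move=> x _; apply/idP/idP.
      case/ideal_addP=> _ [_ [/principalP[y ->] /ideal_scaleP[z zK ->]]] axE.
      have [h] : exists2 h, x - z = b * h & y = a * h.
        by apply: koszul; rewrite mulrBr axE addrK.
      move=> xE _; apply/ideal_addP; exists (b * h), z; rewrite -xE subrK.
      by split=> //; rewrite xE; apply/principalP; exists h.
    case/ideal_addP=> _ [z [/principalP[y ->] zK ->]].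
    apply/ideal_addP; exists (b * (a * y)), (a * z); split; last by ring.
      by apply/principalP; exists (a * y).
    exact: mem_ideal_scale.
  - by move=> x _; apply/two_generatedP; exists x, 0; rewrite mulr0 addr0.
  - move=> _ /two_generatedP[u [v [_ _ ->]]]; apply/ideal_addP.
    exists (a * u), (b * v); split=> //; first exact: mem_ideal_scale.
    apply: mem_ideal_addl; first exact: ideal_scale_closed.
    by apply/principalP; exists v.
have step2 : (colength aC + colength bA = colength (two_generated K) + 0)%N.
  rewrite -(colengthT A); apply: (@colength_iso _ _ _ _ _ b) => //.
  - move=> _ /two_generatedP[u [v [uK _ ->]]].
    apply/ideal_addP; exists (b * v), (a * u); rewrite addrC; split=> //.
      by apply/principalP; exists v.
    exact: mem_ideal_scale.
  - move=> x _; apply/idP/idP.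
      case/two_generatedP=> u [v [uK vK bxE]].
      have [h uE xE] : exists2 h, u = b * h & x - v = a * h.
        by apply: koszul; rewrite mulrBr bxE addrK.
      apply/ideal_addP; exists (a * h), v; rewrite -xE subrK; split=> //.
      rewrite xE; apply: mem_ideal_scale; suff: b * h \in K by [].
      by rewrite -uE.
    case/ideal_addP=> _ [v [/ideal_scaleP[h hC ->] vK ->]].
    by apply/two_generatedP; exists (b * h), v; split=> //; ring.
  - move=> x _; apply: mem_ideal_addl; first exact: ideal_scale_closed.
    by apply/principalP; exists x.
  - move=> _ /ideal_addP[_ [_ [/principalP[x ->] /ideal_scaleP[u uK ->] ->]]].
    apply/ideal_addP; exists (b * x), (a * u); split=> //.
      exact: mem_ideal_scale.
    by apply/two_generatedP; exists u, 0; rewrite mulr0 addr0 ideal0.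
have step3 : (colength C + colength bK = colength K + 0)%N.
  rewrite -(colengthT A); apply: (@colength_iso _ _ _ _ _ b) => //.
  - by move=> x xK; exact: mem_ideal_addr.
  - by move=> x _; apply: mem_ideal_addl => //; apply/principalP; exists x.
have step4 : (H n + colength aC = colength K + colength C)%N.
  apply: (@colength_iso _ _ _ _ _ a) => //.
  - by move=> x xK; apply: mem_ideal_addr => //; exact: ideal_scale_closed.
  - by move=> x _; apply/idP/idP => [/a_regular//|xI]; exact: mem_ideal_expS.
  - by move=> x xC; apply: mem_ideal_addl => //; exact: mem_ideal_scale.
by lia.
Qed.

Lemma reduction_number_le2 r (e0 e1 e2 : int) (N : nat) :
  (forall k, (r <= k)%N -> {subset ideal_exp I k.+1 <= two_generated (ideal_exp I k)}) ->
  (forall n, (N <= n)%N ->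
     (H n.+1)%:Z = e0 * 'C(n.+2, 2)%:Z - e1 * n.+1%:Z + e2) ->
  e2 = e1 - e0 + (H 1)%:Z ->
  forall n, {subset ideal_exp I n.+3 <= two_generated (ideal_exp I n.+2)}.
Proof.
move=> red HE e2E.
pose J := colength (two_generated predT).
pose v n := colength (two_generated (ideal_exp I n.+1)).
have vE n : (v n + H n = J + H n.+1 + H n.+1)%N.
  exact: colength_two_generated red.
have JIfin n : finite_colength (two_generated (ideal_exp I n.+1)).
  pose k := maxn r n.+1; apply: (@finite_colength_exp k.+1) => x.
  move/(red _ (leq_maxl _ _)); apply: two_generatedS.
  exact: ideal_exp_le (leq_maxr _ _).
have v_ge n : (H n.+2 <= v n)%N.
  by apply: colength_le => //; [exact: two_generated_closed|exact: two_generated_exp].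
have v_eq n : (r <= n.+1)%N -> v n = H n.+2.
  move=> le_rn; congr colength; apply: eq_ideal; first exact: two_generated_exp.
  exact: red.
(* The Hilbert polynomial with its variable shifted by one, as [H n] is the length of
   [A / I ^ n]. *)
pose f n : int := e0 * 'C(n.+1, 2)%:Z - e1 * n%:Z + e2 - (H n)%:Z.
have binE n : 'C(n.+1, 2) = ('C(n, 2) + n)%N by rewrite binS bin1.
have f0 n : (N.+1 <= n)%N -> f n = 0.
  by case: n => // n; rewrite ltnS /f => /HE->; rewrite subrr.
(* In large degrees [v n] is [H n.+2], so [vE] makes [J] the second difference of the Hilbert
   polynomial. *)
have JE : J%:Z = e0.
  pose n := (N + r).+1; have := vE n; rewrite v_eq; last by rewrite /n; lia.
  have := f0 n; have := f0 n.+1; have := f0 n.+2; rewrite /f !binE /n; lia.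
have f_vE n : f n.+2 + f n - f n.+1 - f n.+1 = (v n)%:Z - (H n.+2)%:Z.
  by have := vE n; rewrite /f !binE; lia.
have fz n : f n.+1 = 0.
  apply: convex_eventually_zero f0 _ n => [n|]; last by rewrite /f binn e2E; lia.
  by have := f_vE n; have := v_ge n; lia.
move=> n; have -> : ideal_exp I n.+3 = two_generated (ideal_exp I n.+2) => //.
apply/esym/colength_eq => //; [exact: two_generated_closed|exact: two_generated_exp|].
(* The index starts at [n.+1] because [f 0] is not among the values known to vanish; this is why the
   equality begins with [I ^ 3]. *)
by have := f_vE n.+1; rewrite !fz -/(v n.+1); lia.
Qed.

End Reduction.

(** * Relations modulo an integrally closed ideal *)

Section IntegralClosure.
Variables (A : comNzRingType) (I : idealr A) (a b c : A) (r : nat).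
Hypotheses (A_noetherian : noetherian A) (aI : a \in I) (bI : b \in I).
Hypothesis koszul : forall x y, a * x = b * y -> exists2 h, x = b * h & y = a * h.
Hypothesis reduction :
  {subset ideal_exp I r.+1 <= two_generated a b (ideal_exp I r)}.
Hypotheses (cI : c \in I) (c_regular : forall t, c * t = 0 -> t = 0).
Implicit Types (x y z g h u : A) (K N : {pred A}) (n k : nat).

Notation T := (two_generated a b).

Lemma koszul_exp k x y : a ^+ k * x = b * y -> exists2 h, x = b * h & y = a ^+ k * h.
Proof.
elim: k y => [|k IH] y; first by rewrite mul1r => ->; exists y; rewrite ?mul1r.
rewrite exprS -mulrA => /koszul[h /IH[h' -> ->] ->].
by exists h'; rewrite // mulrA.
Qed.

(* [I ^ r] satisfies the last condition, so it lies in the largest such [N]; the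
   second one only records this, to make [N] faithful. *)
Definition reduced_by N : Prop :=
  [/\ ideal_closed N, {subset ideal_exp I r <= N} & {subset ideal_mul I N <= T N}].

Variable N : {pred A}.
Hypotheses (N_reduced : reduced_by N)
  (N_max : forall K, reduced_by K -> {subset N <= K} -> K = N).

(** This is [J ^ k N] with [J := (a, b)]. *)
Let S k := iter k T N.

Let S_closed k : ideal_closed (S k).
Proof.
by have [Nc _ _] := N_reduced; elim: k => [|k IH] //; exact: two_generated_closed.
Qed.

Let aS k u : u \in S k -> a * u \in S k.+1.
Proof.
move=> uS; apply/two_generatedP; exists u, 0; rewrite mulr0 addr0.
by split=> //; exact: ideal0.
Qed.

Let bS k u : u \in S k -> b * u \in S k.+1.
Proof.
move=> uS; apply/two_generatedP; exists 0, u; rewrite mulr0 add0r.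
by split=> //; exact: ideal0.
Qed.

Let IS k i u : i \in I -> u \in S k -> i * u \in S k.+1.
Proof.
move=> iI; elim: k u => [|k IH] u.
  by have [_ _ NT] := N_reduced => uN; apply: NT; exact: mem_ideal_mul.
case/two_generatedP=> v [w [vS wS ->]]; rewrite mulrDr !(mulrCA i).
by apply/two_generatedP; exists (i * v), (i * w); split=> //; exact: IH.
Qed.

Let expS k d z u : (forall j v, v \in S j -> z * v \in S j.+1) ->
  u \in S d -> z ^+ k * u \in S (k + d).
Proof.
move=> zS uS; elim: k => [|k IH]; first by rewrite mul1r.
by rewrite exprS -mulrA addSn; exact: zS.
Qed.

(** A monomial of degree [d.+1] in [a] and [b] other than [a ^+ d.+1] is a multiple of [b]. *)
Let S_split d u : u \in S d.+1 ->
  exists s w, [/\ s \in N, w \in S d & u = a ^+ d.+1 * s + b * w].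
Proof.
elim: d u => [|d IH] u /two_generatedP[v [w [vS wS ->]]].
  by exists v, w; rewrite expr1.
have [s [w' [sN w'S ->]]] := IH _ vS; exists s, (a * w' + w); split=> //.
  by apply: idealD => //; exact: aS.
by rewrite [a ^+ d.+2]exprS; ring.
Qed.

(** The Ratliff-Rush closure of [J ^ k N] relative to [J], tested on [a ^+ M] and [b ^+ M] instead
    of all of [J ^ M]. *)
Let saturation k : {pred A} :=
  [pred g | `[< exists M, a ^+ M * g \in S (M + k) /\ b ^+ M * g \in S (M + k) >]].

Let saturation_closed k : ideal_closed (saturation k).
Proof.
split; first by apply/asboolP; exists 0%N; rewrite !mulr0; split; exact: ideal0.
move=> e u v /asboolP[M [au bu]] /asboolP[M' [av bv]].
have shift z j j' w : (forall i t, t \in S i -> z * t \in S i.+1) ->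
    z ^+ j * w \in S (j + k) -> z ^+ (j' + j) * w \in S (j' + j + k).
  by move=> zS zw; rewrite exprD -mulrA -addnA; exact: expS.
apply/asboolP; exists (M + M')%N.
split; rewrite mulrDr mulrCA; apply: idealD => //; first apply: idealMl => //.
- by rewrite addnC; exact: shift.
- exact: shift.
- by apply: idealMl => //; rewrite addnC; exact: shift.
- exact: shift.
Qed.

Let saturation_mul : {subset ideal_mul I (saturation 0) <= saturation 1}.
Proof.
apply: ideal_mul_sub => // i g iI /asboolP[M [ag bg]]; apply/asboolP; exists M.
by rewrite !(mulrCA _ i) addn1 -[M in S M.+1]addn0; split; exact: IS.
Qed.

(** If [a ^+ M * g = a ^+ M.+1 * s + b * w], the Koszul relation gives [g = a * s + b * g2] with
    [w = a ^+ M * g2], and [g2] lies in [saturation 0], with exponent [M.+1]. *)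
Let saturation1 : {subset saturation 1 <= T (saturation 0)}.
Proof.
move=> g /asboolP[M [ag bg]]; rewrite addn1 in ag bg.
have [s [w [sN wS agE]]] := S_split ag.
have [g2 gE wE] : exists2 g2, g - a * s = b * g2 & w = a ^+ M * g2.
  by apply: koszul_exp; rewrite mulrBr agE exprSr; ring.
apply/two_generatedP; exists s, g2; split; last by rewrite -gE addrC subrK.
  by apply/asboolP; exists 0%N; rewrite !mul1r.
apply/asboolP; exists M.+1; rewrite addn0 exprS -mulrA -wE; split; first exact: aS.
rewrite exprSr -mulrA -gE mulrBr; apply: idealB => //; rewrite mulrCA; apply: aS.
by rewrite -[M in S M]addn0; apply: expS => //; exact: bS.
Qed.

(** [I] times [saturation 0] lies in [saturation 1], hence in [J] times [saturation 0], and [N] is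
    maximal for this property. *)
Let saturation0 : saturation 0 = N.
Proof.
have [_ IN _] := N_reduced.
have N_sat : {subset N <= saturation 0}.
  by move=> u uN; apply/asboolP; exists 0%N; rewrite !mul1r.
apply: N_max => //; split=> //; first by move=> u /IN/N_sat.
by move=> u /saturation_mul/saturation1.
Qed.

Let S2_colon g : a * g \in S 2 -> b * g \in S 2 -> g \in S 1.
Proof.
move=> ag bg; rewrite /S /= -[N in T N]saturation0; apply: saturation1.
by apply/asboolP; exists 1%N; rewrite !expr1.
Qed.

Lemma reduced_by_max_mul x y : a * x + b * y \in ideal_exp I 2 ->
  forall u, u \in N -> x * u \in ideal_mul I N.
Proof.
set z := a * x + b * y => zI.
have [Nc IN NT] := N_reduced.
have zS u : u \in N -> z * u \in S 2.
  move=> uN; move: z zI; have : {subset ideal_exp I 2 <= ideal_colon (S 2) u}.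
    apply: ideal_mul_sub; first exact: ideal_colon_closed.
    move=> i j iI /ideal_exp1 jI.
    have : i * (j * u) \in S 2 by apply: IS => //; exact: IS.
    by have -> : i * (j * u) = u * (i * j) by ring.
  by move=> sub z /sub zu; rewrite mulrC.
(* [z u] equals some [a p + b q] with [p], [q] in [J N]; comparing with [a x u + b y u] leaves a
   Koszul relation, whose factor is [h]. *)
have quo u : u \in N -> exists h, x * u - b * h \in S 1 /\ y * u + a * h \in S 1.
  move/zS/two_generatedP=> [p [q [pS qS zuE]]].
  have [h pE qE] : exists2 h, x * u - p = b * h & q - y * u = a * h.
    apply: koszul; apply/eqP; rewrite -subr_eq0; apply/eqP.
    have -> : a * (x * u - p) - b * (q - y * u) = z * u - (a * p + b * q).
      by rewrite /z; ring.
    by rewrite zuE subrr.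
  by exists h; rewrite -pE -qE subKr addrC subrK.
pose N' : {pred A} := [pred h | `[< exists2 u, u \in N &
  x * u - b * h \in S 1 /\ y * u + a * h \in S 1 >]].
have N'c : ideal_closed N'.
  split; first by apply/asboolP; exists 0; rewrite ?ideal0 // !mulr0 subr0 addr0 ideal0.
  move=> e h k /asboolP[u uN [xu yu]] /asboolP[v vN [xv yv]]; apply/asboolP.
  exists (e * u + v); first by apply: idealD => //; exact: idealMl.
  have -> : x * (e * u + v) - b * (e * h + k) = e * (x * u - b * h) + (x * v - b * k).
    by ring.
  have -> : y * (e * u + v) + a * (e * h + k) = e * (y * u + a * h) + (y * v + a * k).
    by ring.
  by split; apply: idealD => //; exact: idealMl.
have NN' : {subset N <= N'}.
  move=> h hN; apply/asboolP; exists 0; first exact: ideal0.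
  rewrite !mulr0 sub0r add0r; split; last exact: (@aS 0).
  by apply: idealN => //; exact: (@bS 0).
have N'E : N' = N.
  apply: N_max => //; split=> //; first by move=> u /IN/NN'.
  apply: ideal_mul_sub; first exact: two_generated_closed.
  move=> i h iI /asboolP[u uN [pS qS]].
  have /two_generatedP[n1 [n2 [n1N n2N iuE]]] : i * u \in S 1 by exact: IS.
  have [h1 [p1 q1]] := quo _ n1N; have [h2 [p2 q2]] := quo _ n2N.
  (* From [i u = a n1 + b n2] one expects [i h] to be [a h1 + b h2] modulo [J N]; the products of
     the difference with [a] and [b] are in [J ^ 2 N], so [S2_colon] applies. *)
  have dS : i * h - a * h1 - b * h2 \in S 1.
    apply: S2_colon.
      have -> : a * (i * h - a * h1 - b * h2) =
          i * (y * u + a * h) - a * (y * n1 + a * h1) - b * (y * n2 + a * h2)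
          - y * (i * u - (a * n1 + b * n2)) by ring.
      rewrite iuE subrr mulr0 subr0.
      by apply: idealB => //; [apply: idealB => //; [exact: IS|exact: aS]|exact: bS].
    have -> : b * (i * h - a * h1 - b * h2) =
        a * (x * n1 - b * h1) + b * (x * n2 - b * h2) - i * (x * u - b * h)
        + x * (i * u - (a * n1 + b * n2)) by ring.
    rewrite iuE subrr mulr0 addr0.
    by apply: idealB => //; [apply: idealD => //; [exact: aS|exact: bS]|exact: IS].
  have -> : i * h = (i * h - a * h1 - b * h2) + (a * h1 + b * h2) by ring.
  apply: idealD; first exact: two_generated_closed.
    exact: two_generatedS dS.
  apply/two_generatedP; exists h1, h2; split=> //.
    by apply/asboolP; exists n1.
  by apply/asboolP; exists n2.
move=> u uN; have [h [pS qS]] := quo u uN.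
have hN : h \in N by rewrite -N'E; apply/asboolP; exists u.
have INc : ideal_closed (ideal_mul I N).
  by apply: ideal_mul_closed; exact: idealr_ideal_closed.
rewrite -[x * u](subrK (b * h)); apply: idealD => //; last exact: mem_ideal_mul.
case/two_generatedP: pS => p [q [pN qN ->]].
by apply: idealD => //; exact: mem_ideal_mul.
Qed.

End IntegralClosure.

Lemma integrally_closed_relation (A : comNzRingType) (I : idealr A) (a b c : A) r :
  noetherian A -> a \in I -> b \in I ->
  (forall x y, a * x = b * y -> exists2 h, x = b * h & y = a * h) ->
  {subset ideal_exp I r.+1 <= two_generated a b (ideal_exp I r)} ->
  c \in I -> (forall t, c * t = 0 -> t = 0) ->
  integrally_closed I ->
  forall x y, a * x + b * y \in ideal_exp I 2 -> x \in I.
Proof.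
move=> An aI bI koszul red cI creg I_closed x y xyI; apply: I_closed.
have [|| N Nred Nmax] := @noetherian_max A (reduced_by I a b r) An.
- by move=> K [].
- exists (ideal_exp I r); split; [exact: ideal_exp_closed|by []|exact: red].
have [Nc IN _] := Nred.
(* [c ^+ r] is a nonzerodivisor in [I ^ r], hence in [N]. *)
apply: (@integral_of_ideal _ _ N x (c ^+ r)) => //.
- apply: IN; elim: r {red Nred Nmax} => [|r IH] //.
  by rewrite exprS; exact: mem_ideal_expS.
- move=> t; elim: r {red Nred Nmax IN} t => [|r IH] t; first by rewrite mul1r.
  by rewrite exprS -mulrA => /creg/IH.
- by apply: (reduced_by_max_mul _ _ koszul Nred Nmax xyI).
Qed.

(** * Regular sequences *)

Section KoszulExchange.
Variable R : comNzRingType.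
Implicit Types (a b c t x y z : R) (Q : {pred R}).

(* The relations [a x = b y] modulo the trivial ones are killed by powers of
   [c1] and [c2], but no nonzero class is killed by both [c1] and [c2]. *)
Lemma koszul_of_regular c1 c2 a b n :
  (forall t, c1 * t = 0 -> t = 0) ->
  (forall t s, c2 * t = c1 * s -> exists t', t = c1 * t') ->
  c1 ^+ n \in two_generated a b predT -> c2 ^+ n \in two_generated a b predT ->
  forall x y, a * x = b * y -> exists2 h, x = b * h & y = a * h.
Proof.
move=> c1_reg c2_reg c1n c2n.
pose Z x y := a * x = b * y; pose B x y := exists2 h, x = b * h & y = a * h.
have ZM c x y : Z x y -> Z (c * x) (c * y) by rewrite /Z !(mulrCA _ c) => ->.
have BM c x y : B x y -> B (c * x) (c * y).
  by move=> [h -> ->]; exists (c * h); rewrite mulrCA.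
have killB c x y : c ^+ n \in two_generated a b predT -> Z x y ->
    B (c ^+ n * x) (c ^+ n * y).
  rewrite /Z => /two_generatedP[p [q [_ _ ->]]] xy; exists (p * y + q * x).
    have -> : (a * p + b * q) * x = p * (a * x) + b * q * x by ring.
    by rewrite xy; ring.
  have -> : (a * p + b * q) * y = a * p * y + q * (b * y) by ring.
  by rewrite -xy; ring.
have c1X_reg k t : c1 ^+ k * t = 0 -> t = 0.
  by elim: k => [|k IH]; [rewrite mul1r|rewrite exprS -mulrA => /c1_reg].
have ann0 t : a * t = 0 -> b * t = 0 -> t = 0.
  move=> at0 bt0; apply: (c1X_reg n); case/two_generatedP: c1n => p [q [_ _ ->]].
  by rewrite mulrDl ![_ * _ * t]mulrAC at0 bt0 !mul0r addr0.
(* As [a] and [b] have no common annihilator, [c2 * h1 = c1 * h2]; then [h1] is a multiple of [c1],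
   and [c1] can be cancelled. *)
have socle x y : B (c1 * x) (c1 * y) -> B (c2 * x) (c2 * y) -> B x y.
  move=> [h1 x1 y1] [h2 x2 y2].
  have /eqP : c2 * h1 - c1 * h2 = 0.
    apply: ann0.
      have -> : a * (c2 * h1 - c1 * h2) = c2 * (a * h1) - c1 * (a * h2) by ring.
      by rewrite -y1 -y2 mulrCA subrr.
    have -> : b * (c2 * h1 - c1 * h2) = c2 * (b * h1) - c1 * (b * h2) by ring.
    by rewrite -x1 -x2 mulrCA subrr.
  rewrite subr_eq0 => /eqP/c2_reg[h h1E]; exists h; apply/eqP; rewrite -subr_eq0.
    by apply/eqP/c1_reg; rewrite mulrBr x1 h1E mulrCA subrr.
  by apply/eqP/c1_reg; rewrite mulrBr y1 h1E mulrCA subrr.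
have socle2 k x y : B (c1 * x) (c1 * y) -> B (c2 ^+ k * x) (c2 ^+ k * y) -> B x y.
  move=> B1; elim: k => [|k IH]; first by rewrite !mul1r.
  rewrite exprS -!mulrA => B2; apply: IH; apply: socle => //.
  by rewrite !(mulrCA c1); exact: BM.
have socle1 k x y : B (c1 ^+ k * x) (c1 ^+ k * y) ->
    B (c2 ^+ n * x) (c2 ^+ n * y) -> B x y.
  move=> + B2; elim: k => [|k IH]; first by rewrite !mul1r.
  rewrite exprS -!mulrA => B1; apply: IH; apply: (socle2 n _ _ B1).
  by rewrite !(mulrCA (c2 ^+ n)); exact: BM.
by move=> x y xy; apply: (socle1 n); exact: killB.
Qed.

(** If 1 were outside [Q], multiplying it by powers of the elements of [s] as long as the product
    stays outside [Q] would give a [z] outside [Q] that all of [s] multiplies into [Q]. *)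
Lemma ideal_one_of_powers Q (s : seq R) : ideal_closed Q ->
  (forall z, {in s, forall c, c * z \in Q} -> z \in Q) ->
  {in s, forall c, exists n, c ^+ n \in Q} -> 1 \in Q.
Proof.
move=> Qc sQ powQ.
suff H (t : seq R) : {subset t <= s} -> exists2 z, (1 \notin Q -> z \notin Q) &
    {in t, forall c, c * z \in Q}.
  have [z zQ /sQ zQ'] := H s (fun _ => id).
  by apply: contraT => /zQ; rewrite zQ'.
elim: t => [|c t IH] ts; first by exists 1.
have [|z zQ tz] := IH; first by move=> w wt; apply: ts; rewrite in_cons wt orbT.
have [|n cnQ] := powQ c; first by apply: ts; exact: mem_head.
have exk : exists k, c ^+ k * z \in Q by exists n; exact: idealMr.
case: (ex_minnP exk) => -[|k] ckz kmin.
  exists z => // d _; rewrite mul1r in ckz; exact: idealMl.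
exists (c ^+ k * z) => [_|d].
  by apply/negP => /kmin; rewrite ltnn.
rewrite in_cons => /orP[/eqP->|dt]; first by rewrite mulrA -exprS.
by rewrite mulrCA; apply: idealMl => //; exact: tz.
Qed.

Lemma ideal_gen1P (c t : R) : reflect (exists s, t = c * s) (t \in ideal_gen [:: c]).
Proof.
apply: (iffP (ideal_gen_consP _ _ _)).
  by case=> s [z []]; rewrite ideal_gen0 => /eqP-> ->; exists s; rewrite addr0 mulrC.
by case=> s ->; exists s, 0; rewrite ideal_gen0 addr0 mulrC.
Qed.

Lemma ideal_gen2P (c d t : R) :
  reflect (exists x y, t = c * x + d * y) (t \in ideal_gen [:: c; d]).
Proof.
apply: (iffP (ideal_gen_consP _ _ _)).
  by case=> x [z [/ideal_gen1P[y ->] ->]]; exists x, y; rewrite (mulrC x).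
case=> x [y ->]; exists x, (d * y); rewrite (mulrC x); split=> //.
by apply/ideal_gen1P; exists y.
Qed.

(* Three elements that are nilpotent modulo [(a, b)] do not form a regular
   sequence: the Koszul complex of [a, b] would be acyclic. *)
Lemma no_regular_seq3 a b c1 c2 c3 :
  (forall t, a * t = 0 -> t = 0) ->
  (forall t s, b * t = a * s -> exists t', t = a * t') ->
  1 \notin ideal_gen [:: a; b] ->
  {in [:: c1; c2; c3], forall c, exists n, c ^+ n \in ideal_gen [:: a; b]} ->
  (forall t, c1 * t = 0 -> t = 0) ->
  (forall t s, c2 * t = c1 * s -> exists t', t = c1 * t') ->
  ~ (forall t s1 s2, c3 * t = c1 * s1 + c2 * s2 ->
       exists t1 t2, t = c1 * t1 + c2 * t2).
Proof.
move=> a_reg b_reg ab1 powQ c1_reg c2_reg c3_reg; case/negP: ab1.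
have koszul x y : a * x = b * y -> exists2 h, x = b * h & y = a * h.
  move=> xy; have [h yE] := b_reg _ _ (esym xy); exists h => //.
  apply/eqP; rewrite -subr_eq0; apply/eqP/a_reg.
  by rewrite mulrBr xy yE mulrCA subrr.
apply: ideal_one_of_powers powQ; first exact: ideal_gen_closed.
move=> z zQ; have /ideal_gen2P[h1 [k1 z1]] : c1 * z \in ideal_gen [:: a; b].
  by apply: zQ; rewrite !inE eqxx.
have /ideal_gen2P[h2 [k2 z2]] : c2 * z \in ideal_gen [:: a; b].
  by apply: zQ; rewrite !inE eqxx orbT.
have /ideal_gen2P[h3 [k3 z3]] : c3 * z \in ideal_gen [:: a; b].
  by apply: zQ; rewrite !inE eqxx !orbT.
(* Eliminating [z] between two of the relations leaves a relation between [a] and [b], which is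
   trivial with factor [t]. *)
have pair c d h k h' k' : c * z = a * h + b * k -> d * z = a * h' + b * k' ->
    exists2 t, d * h - c * h' = b * t & c * k' - d * k = a * t.
  move=> cz dz; apply: koszul; apply/eqP; rewrite -subr_eq0; apply/eqP.
  have -> : a * (d * h - c * h') - b * (c * k' - d * k) =
            d * (a * h + b * k) - c * (a * h' + b * k') by ring.
  by rewrite -cz -dz mulrCA subrr.
have [t12 h12 k12] := pair _ _ _ _ _ _ z1 z2.
have [t13 h13 k13] := pair _ _ _ _ _ _ z1 z3.
have [t23 h23 k23] := pair _ _ _ _ _ _ z2 z3.
(* The three factors satisfy [c1 t23 - c2 t13 + c3 t12 = 0], seen after multiplication by [a], so
   [t12] lies in [(c1, c2)]. *)
have [|u [v t12E]] := c3_reg t12 (- t23) t13.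
  apply/eqP; rewrite -subr_eq0; apply/eqP/a_reg.
  have -> : a * (c3 * t12 - (c1 * - t23 + c2 * t13)) =
            c3 * (a * t12) + c1 * (a * t23) - c2 * (a * t13) by ring.
  by rewrite -k12 -k13 -k23; ring.
(* Changing [h1], [k1] by [- b v], [a v] does not alter [a h1 + b k1], and makes both of them
   multiples of [c1]. *)
have [g hE] : exists g, h1 - b * v = c1 * g.
  apply: (c2_reg _ (h2 + b * u)); apply/eqP; rewrite -subr_eq0; apply/eqP.
  have -> : c2 * (h1 - b * v) - c1 * (h2 + b * u) =
            (c2 * h1 - c1 * h2) - b * (c1 * u + c2 * v) by ring.
  by rewrite h12 t12E subrr.
have [g' kE] : exists g', k1 + a * v = c1 * g'.
  apply: (c2_reg _ (k2 - a * u)); apply/eqP; rewrite -subr_eq0; apply/eqP.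
  have -> : c2 * (k1 + a * v) - c1 * (k2 - a * u) =
            a * (c1 * u + c2 * v) - (c1 * k2 - c2 * k1) by ring.
  by rewrite k12 t12E subrr.
apply/ideal_gen2P; exists g, g'; apply/eqP; rewrite -subr_eq0; apply/eqP/c1_reg.
have -> : c1 * (z - (a * g + b * g')) = c1 * z - (a * (c1 * g) + b * (c1 * g')) by ring.
by rewrite -hE -kE z1; ring.
Qed.

End KoszulExchange.

Section RegularSequences.
Variable R : comNzRingType.
Implicit Types (c t : R) (s : seq R).

Lemma regular_seq_nil : regular_seq ([::] : seq R).
Proof. by split=> //; rewrite ideal_gen0 oner_eq0. Qed.

Lemma regular_seq1 c s : regular_seq (c :: s) -> forall t, c * t = 0 -> t = 0.
Proof.
move=> [reg _] t ct; have := reg 0%N t isT.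
by rewrite /= ?take0 !ideal_gen0 ct eqxx => /(_ isT)/eqP.
Qed.

Lemma regular_seq2 c d s : regular_seq [:: c, d & s] ->
  forall t u, d * t = c * u -> exists t', t = c * t'.
Proof.
move=> [reg _] t u tu; apply/ideal_gen1P; have := reg 1%N t isT.
by rewrite /= ?take0; apply; apply/ideal_gen1P; exists u.
Qed.

Lemma regular_seq3 c d e s : regular_seq [:: c, d, e & s] ->
  forall t u v, e * t = c * u + d * v -> exists x y, t = c * x + d * y.
Proof.
move=> [reg _] t u v tuv; apply/ideal_gen2P; have := reg 2%N t isT.
by rewrite /= ?take0; apply; apply/ideal_gen2P; exists u, v.
Qed.

End RegularSequences.

(** * The associated graded ring *)

Section AssociatedGraded.
Variables (A : comNzRingType) (m I : idealr A) (a b : A).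
Hypotheses (aI : a \in I) (bI : b \in I) (m_radical : radical I =i m).
Hypothesis a_regular :
  forall n p, a * p \in ideal_exp I n.+1 -> p \in ideal_exp I n.
Hypothesis b_regular : forall n p q, p \in ideal_exp I n -> q \in ideal_exp I n ->
  b * p - a * q \in ideal_exp I n.+2 -> p \in mod_linear I a n.
Hypothesis reduction_number :
  forall n, {subset ideal_exp I n.+3 <= two_generated a b (ideal_exp I n.+2)}.
Implicit Types (P Q : rees I) (g h : assoc_graded I).

Hint Resolve ideal_exp_closed idealr_ideal_closed : core.

Definition symbol P : assoc_graded I := \pi_({ideal_quot rees_shift I})%qT P.

HB.instance Definition _ := GRing.RMorphism.copy symbol
  (\pi_({ideal_quot rees_shift I})%qT : rees I -> assoc_graded I).

Lemma symbol_eq0 P : (symbol P == 0) = (P \in rees_shift I).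
Proof. by rewrite -[P in RHS]subr0 Quotient.idealrBE -[0 in LHS](rmorph0 symbol). Qed.

Lemma symbolP g : exists P, g = symbol P.
Proof. by exists (repr g); rewrite /symbol reprK. Qed.

Lemma symbol_eq P Q : (symbol P = symbol Q) <-> (P - Q \in rees_shift I).
Proof.
rewrite -symbol_eq0 rmorphB subr_eq0.
by split=> /eqP.
Qed.

Let a1 : a \in ideal_exp I 1. Proof. by rewrite ideal_exp1E. Qed.
Let b1 : b \in ideal_exp I 1. Proof. by rewrite ideal_exp1E. Qed.

Notation a' := (symbol (rees_mono I 1 a)).
Notation b' := (symbol (rees_mono I 1 b)).

Lemma symbol_regular1 g : a' * g = 0 -> g = 0.
Proof.
have [P ->] := symbolP g; rewrite -rmorphM => /eqP; rewrite symbol_eq0.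
move=> /rees_shiftP aP; apply/eqP; rewrite symbol_eq0; apply/rees_shiftP => n.
by have := aP n.+1; rewrite coef_rees_monoM // subn1 => /a_regular.
Qed.

(** The components of [P] are treated separately: one in [mod_linear I a n] has a symbol divisible
    by that of [a], the term in [I ^ n.+1] having symbol 0. *)
Lemma symbol_regular2 g h : b' * g = a' * h -> exists g', g = a' * g'.
Proof.
have [P ->] := symbolP g; have [Q ->] := symbolP h; rewrite -!rmorphM.
move=> /symbol_eq/rees_shiftP bP; apply/ideal_gen1P.
have gc := ideal_gen_closed [:: a']; rewrite [P]rees_sumE rmorph_sum /=.
apply: ideal_sum => // n _; have PI := rees_coef P n.
have : (rees_val P)`_n \in mod_linear I a n.
  apply: (@b_regular n _ (rees_val Q)`_n) => //; first exact: rees_coef.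
  by have := bP n.+1; rewrite coefB !coef_rees_monoM // !subn1.
move: (rees_val P)`_n PI => p; case: (nat_of_ord n) => [|{}n] pI.
  move=> pI'; have /eqP-> : symbol (rees_mono I 0 p) == 0.
    by rewrite symbol_eq0 rees_mono_shift // ideal_exp1E.
  exact: ideal0.
case/ideal_addP=> _ [v [/ideal_scaleP[u uI ->] vI ->]].
have vI' := ideal_expS_sub vI.
have /eqP v0 : symbol (rees_mono I n.+1 v) == 0.
  by rewrite symbol_eq0 rees_mono_shift.
rewrite rees_monoD //; last exact: mem_ideal_expS.
rewrite rmorphD /= v0 addr0 -add1n rees_monoM // rmorphM.
by apply/ideal_gen1P; exists (symbol (rees_mono I n u)).
Qed.

Lemma symbol_proper : 1 \notin ideal_gen [:: a'; b'].
Proof.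
apply/ideal_gen2P => -[g [h]].
have [P ->] := symbolP g; have [Q ->] := symbolP h.
rewrite -!rmorphM -rmorphD -(rmorph1 symbol) => /symbol_eq/rees_shiftP/(_ 0%N).
by rewrite coefB coefD !coef_rees_monoM // coef1 addr0 subr0 ideal_exp1E idealr1.
Qed.

Lemma symbol_in_max P : (rees_val P)`_0 \in m -> symbol P \in graded_max I m.
Proof. by move=> P0; apply/asboolP; exists P. Qed.

Lemma graded_maxP g :
  g \in graded_max I m -> exists2 P, g = symbol P & (rees_val P)`_0 \in m.
Proof. by move/asboolP. Qed.

Let order s P := forall i, (i < s)%N -> (rees_val P)`_i = 0.

Let orderM s t P Q : order s P -> order t Q -> order (s + t) (P * Q).
Proof.
move=> Ps Qt i lt_i; rewrite [LHS]coefM big1 // => j _.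
have [/Ps->|le_sj] := ltnP j s; first by rewrite mul0r.
by rewrite Qt ?mulr0 //; have := ltn_ord j; lia.
Qed.

(** Some power [P ^+ k] has its constant term in [I], hence the same symbol as [Q], which starts in
    degree 1. The components of [Q ^+ 3] have degree [i] at least 3, where
    [I ^ i = (a, b) I ^ i.-1]. *)
Lemma graded_max_nilpotent g : g \in graded_max I m ->
  exists n, g ^+ n \in ideal_gen [:: a'; b'].
Proof.
case/graded_maxP=> P -> ; rewrite -m_radical => /asboolP[k PkI].
have gc := ideal_gen_closed [:: a'; b'].
pose c := (rees_val (P ^+ k))`_0; pose Q := P ^+ k - rees_mono I 0 c.
have cI : c \in I.
  suff -> : c = (rees_val P)`_0 ^+ k by [].
  rewrite /c; elim: k {PkI c Q} => [|k IH]; first by rewrite !expr0 coef1.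
  by rewrite !exprS [LHS]coef0M IH.
have Q1 : order 1 Q.
  case=> // _; have -> : (rees_val Q)`_0 = c - (rees_val (rees_mono I 0 c))`_0.
    exact: coefB.
  by rewrite rees_monoE // expr0 alg_polyC coefC subrr.
have QE : symbol (P ^+ k) = symbol Q.
  apply/symbol_eq; rewrite /Q opprB addrC subrK rees_mono_shift //.
  by rewrite ideal_exp1E.
exists (k * 3)%N; rewrite exprM -rmorphXn /= QE -rmorphXn /=.
have Q3 : order 3 (Q ^+ 3) by exact: orderM Q1 (orderM Q1 Q1).
rewrite [Q ^+ 3]rees_sumE rmorph_sum /=; apply: ideal_sum => // i _.
have QI := rees_coef (Q ^+ 3) i; have [/Q3->|le_3i] := ltnP i 3.
  by rewrite rees_mono0 rmorph0 ideal0.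
move: (rees_val _)`_i QI => p; case: (nat_of_ord i) le_3i => [|[|[|{}i]]] // _ pI.
have /two_generatedP[u [v [uI vI ->]]] := reduction_number pI.
apply/ideal_gen2P; exists (symbol (rees_mono I i.+2 u)), (symbol (rees_mono I i.+2 v)).
rewrite rees_monoD; [|exact: mem_ideal_expS|exact: mem_ideal_expS].
by rewrite -add1n !rees_monoM // rmorphD !rmorphM.
Qed.

Lemma depth_graded_max_eq2 : depth (graded_max I m) 2.
Proof.
split.
  exists [:: a'; b']; split=> //.
    have mono0 x : x \in ideal_exp I 1 -> symbol (rees_mono I 1 x) \in graded_max I m.
      move=> xI; apply: symbol_in_max; rewrite rees_monoE // coefZ coefXn mulr0.
      exact: rpred0.
    by move=> g; rewrite in_cons mem_seq1 => /orP[]/eqP->; exact: mono0.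
  split; last exact: symbol_proper.
  case=> [|[|//]] g _ /=.
    by rewrite !ideal_gen0 => /eqP/symbol_regular1->.
  by move/ideal_gen1P=> [h /symbol_regular2[g' ->]]; apply/ideal_gen1P; exists g'.
move=> s sm sreg; rewrite leqNgt; apply/negP => lt2s.
case: s lt2s sm sreg => [|c1 [|c2 [|c3 s]]] // _ sm sreg.
apply: (@no_regular_seq3 _ a' b' c1 c2 c3).
- exact: symbol_regular1.
- exact: symbol_regular2.
- exact: symbol_proper.
- move=> c cs; apply: graded_max_nilpotent; apply: sm.
  by move: cs; rewrite !in_cons orbF => /or3P[]/eqP->; rewrite eqxx ?orbT.
- exact: regular_seq1 sreg.
- exact: regular_seq2 sreg.
- exact: regular_seq3 sreg.
Qed.

End AssociatedGraded.

(** * Hilbert coefficients in dimension 2 and the depth dichotomy *)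

Lemma quot_length_colength (R : comNzRingType) (J : {pred R}) l :
  ideal_closed J -> quot_length J l -> finite_colength J /\ colength J = l.
Proof.
move=> Jc [Jl lmax]; have Jlen : is_length J predT l.
  by split=> [|k /(quot_chainE _ Jc)/lmax//]; exact/quot_chainE.
by split; [exists l; exact: Jlen.2|exact: colengthE].
Qed.

Lemma cohen_macaulay_depth (R : comNzRingType) (m : {pred R}) d :
  krull_dim R d -> cohen_macaulay m -> depth m d.
Proof.
move=> [Rd dmax] [k [Rk kmax] mk]; suff -> : d = k by [].
by apply/eqP; rewrite eqn_leq kmax // dmax.
Qed.

Lemma hilbert_coefs2 (A : comNzRingType) (I : idealr A) (e : nat -> int) :
  hilbert_coefs 2 I e ->
  (forall n, finite_colength (ideal_exp I n)) /\
  exists N, forall n, (N <= n)%N -> (colength (ideal_exp I n.+1))%:Z =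
    e 0%N * 'C(n.+2, 2)%:Z - e 1%N * n.+1%:Z + e 2%N.
Proof.
case=> N HE; have len n : (N <= n)%N -> exists2 l,
    finite_colength (ideal_exp I n.+1) /\ colength (ideal_exp I n.+1) = l &
    l%:Z = e 0%N * 'C(n.+2, 2)%:Z - e 1%N * n.+1%:Z + e 2%N.
  move=> /HE[l /(quot_length_colength (ideal_exp_closed I n.+1)) Il lE].
  exists l => //; rewrite lE !big_ord_recl big_ord0 /= !subn0 subnn.
  rewrite addn2 addn1 bin1 addn0 bin0 /bump /= !expr0 expr1 !add1n.
  by rewrite sqrrN expr1n; ring.
split=> [n|]; last by exists N => n /len[l [_ ->] ->].
have [l [fin _] _] := len (maxn N n) (leq_maxl _ _).
apply: finite_colengthS fin; first exact: ideal_exp_closed.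
by apply: ideal_exp_le; apply: leqW; exact: leq_maxr.
Qed.

Theorem lemma3p3 (A : comNzRingType) (m I : idealr A)
    (A_local : local_ring m) (A_noetherian : noetherian A)
    (A_dim2 : krull_dim A 2) (A_CM : cohen_macaulay m)
    (residue_infinite : infinite_set [set: {ideal_quot m}])
    (I_primary : primary_to m I) (I_closed : integrally_closed I)
    (e : nat -> int) (e_hilbert : hilbert_coefs 2 I e)
    (l : nat) (l_length : quot_length I l)
    (e2E : e 2%N = e 1%N - e 0%N + l%:Z) :
  depth (graded_max I m) 0 \/ depth (graded_max I m) 2.
Proof.
have [g_reg|no_reg] := pselect (exists2 g, g \in graded_max I m &
    forall h, g * h = 0 -> h = 0); last first.
  left; split; first by exists [::]; split=> //; exact: regular_seq_nil.
  case=> [|g s] // gs greg; case: no_reg; exists g.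
    by apply: gs; exact: mem_head.
  exact: regular_seq1 greg.
right; case: g_reg => _ /graded_maxP[P -> Pm] P_reg.
have m_rad : radical I =i m by case: I_primary.
have I_sub : {subset I <= m}.
  by move=> x xI; rewrite -m_rad; apply/asboolP; exists 1%N; rewrite expr1.
have Ic := idealr_ideal_closed I.
have [exp_fin [N HE]] := hilbert_coefs2 e_hilbert.
have [_ I1] := quot_length_colength Ic l_length.
have [lam lam_unit] := unit_differences A_local A_noetherian residue_infinite.
have tf n p : p \in ideal_exp I n ->
    (forall x, x \in I -> x * p \in ideal_exp I n.+2) -> p \in ideal_exp I n.+1.
  apply: (graded_torsion_free m_rad Pm) => Q; rewrite -!symbol_eq0 => /eqP.
  by rewrite rmorphM => /P_reg->.
have [a aI a_reg] := regular_linear_form A_noetherian lam_unit tf.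
have [b bI [n0 b_reg]] := generic_linear_form_mod I A_noetherian lam_unit a.
have [r red] : exists r, forall n, (r <= n)%N ->
    {subset ideal_exp I n.+1 <= two_generated a b (ideal_exp I n)}.
  (* The polynomial formula for the colength of [I ^ n] holds from [n = N.+1] on, whence [n1]. *)
  apply: (reduction_exists A_local A_noetherian I_sub aI bI exp_fin a_reg
    (n0 := n0) (n1 := N.+1) b_reg).
  case=> [//|n]; rewrite ltnS => le_Nn.
  have := HE n le_Nn; have := HE n.+1 (leqW le_Nn).
  have := HE n.+2 (leqW (leqW le_Nn)); have := HE n.+3 (leqW (leqW (leqW le_Nn))).
  have binE k : 'C(k.+1, 2) = ('C(k, 2) + k)%N by rewrite binS bin1.
  by rewrite !binE; lia.
have [[s [s2 sm s_reg]] _] := cohen_macaulay_depth A_dim2 A_CM.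
case: s s2 sm s_reg => [|c1 [|c2 [|//]]] // _ sm s_reg.
have c1_reg := regular_seq1 s_reg; have c2_reg := regular_seq2 s_reg.
have powI c : c \in m -> exists k, forall n, c ^+ (k * n) \in ideal_exp I n.
  rewrite -m_rad => /asboolP[k ck]; exists k; elim=> [|n IH] //.
  by rewrite mulnS exprD; exact: mem_ideal_expS.
have [k1 c1I] : exists k, forall n, c1 ^+ (k * n) \in ideal_exp I n.
  by apply/powI/sm; rewrite mem_head.
have [k2 c2I] : exists k, forall n, c2 ^+ (k * n) \in ideal_exp I n.
  by apply/powI/sm; rewrite !in_cons eqxx orbT.
have Jc : ideal_closed (two_generated a b predT).
  by apply: two_generated_closed; exact: idealT.
have powJ c k : c ^+ (k * r.+1) \in ideal_exp I r.+1 ->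
    c ^+ (k * r.+1) \in two_generated a b predT.
  by move/(red r (leqnn r)); exact: two_generatedS.
have koszul : forall x y, a * x = b * y -> exists2 h, x = b * h & y = a * h.
  (* The sum is a common exponent: [c1 ^+ (k1 * r.+1)] and [c2 ^+ (k2 * r.+1)] lie in [I ^ r.+1],
     hence in [(a, b)]. *)
  apply: (@koszul_of_regular _ c1 c2 a b (k1 * r.+1 + k2 * r.+1)) => //.
    by rewrite exprD; apply: idealMr => //; exact: powJ.
  by rewrite exprD; apply: idealMl => //; exact: powJ.
have koszul' x y : b * x = a * y -> exists2 h, x = a * h & y = b * h.
  by move/esym/koszul => [h -> ->]; exists h.
have red2 : forall n, {subset ideal_exp I n.+3 <= two_generated a b (ideal_exp I n.+2)}.
  apply: (reduction_number_le2 aI bI exp_fin a_reg koszul red HE).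
  by rewrite ideal_exp1E I1.
apply: (depth_graded_max_eq2 aI bI m_rad a_reg _ red2) => n p q pI qI bpq.
case: n pI qI bpq => [_ _|n pI qI] bpq.
  (* In degree 0, [p] has to lie in [I]; [a] and [b] change places because the lemma controls the
     coefficient of its first generator. *)
  apply: (@integrally_closed_relation _ I b a (c1 ^+ k1) r _ _ _ koszul' _ _ _ _ p (- q)) => //.
  - move=> x /(red r (leqnn r))/two_generatedP[u [v [uI vI ->]]].
    by apply/two_generatedP; exists v, u; rewrite addrC.
  - by rewrite -ideal_exp1E -[k1]muln1.
  - move=> t; elim: (k1) => [|k IH]; first by rewrite mul1r.
    by rewrite exprS -mulrA => /c1_reg.
  - by rewrite mulrN.
(* In degree [n.+1], the element is rewritten as [a s + b t] with [s], [t] in [I ^ n.+2]; the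
   comparison is a Koszul relation, so [p = a h + t], and [a_reg] puts [h] in [I ^ n]. *)
have /two_generatedP[s [t [sI tI bpqE]]] := red2 _ _ bpq.
have [h _ ptE] : exists2 h, q + s = b * h & p - t = a * h.
  apply: koszul; apply/eqP; rewrite -subr_eq0; apply/eqP.
  have -> : a * (q + s) - b * (p - t) = (a * s + b * t) - (b * p - a * q) by ring.
  by rewrite bpqE subrr.
apply/ideal_addP; exists (a * h), t; rewrite -ptE subrK; split=> //.
rewrite ptE; apply: mem_ideal_scale; apply: a_reg; rewrite -ptE.
apply: idealB => //; first exact: ideal_exp_closed.
exact: ideal_expS_sub.
Qed.
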